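(* Let $D$ and $D'$ be two diagrams which represent the same oriented (classical or virtual) link $L$. Then the fundamental mc-biquandle $\mathcal{MCB}(D)$ is isomorphic, as an mc-biquandle, to the fundamental mc-biquandle $\mathcal{MCB}(D')$.
   Context: **mc-biquandles.** An mc-biquandle is a set $X$ with two pairs of binary operations $\underline{\triangleright}^s,\overline{\triangleright}^s$ and $\underline{\triangleright}^m,\overline{\triangleright}^m$ such that: (i) for all $x\in X$, $x\,\overline{\triangleright}^s x=x\,\underline{\triangleright}^s x$; (ii) for all $y\in X$ and $j\in\{s,m\}$, the maps $\alpha^j_y,\beta^j_y:X\to X$, $\alpha^j_y(x)=x\,\underline{\triangleright}^j y$, $\beta^j_y(x)=x\,\overline{\triangleright}^j y$, are invertible, and the map $S^j:X\times X\to X\times X$, $S^j(x,y)=(y\,\overline{\triangleright}^j x,\;x\,\underline{\triangleright}^j y)$, is invertible; (iii) for all $x,y,z\in X$ and all $(j,k,l)\in\{(s,s,s),(s,m,m),(m,s,m),(m,m,s),(m,m,m)\}$: $$(x\,\overline{\triangleright}^k y)\,\overline{\triangleright}^l (z\,\overline{\triangleright}^j y)=(x\,\overline{\triangleright}^l z)\,\overline{\triangleright}^k (y\,\underline{\triangleright}^j z),$$ $$(x\,\underline{\triangleright}^l y)\,\overline{\triangleright}^j (z\,\underline{\triangleright}^k y)=(x\,\overline{\triangleright}^j z)\,\underline{\triangleright}^l (y\,\overline{\triangleright}^k z),$$ $$(x\,\underline{\triangleright}^k y)\,\underline{\triangleright}^j (z\,\underline{\triangleright}^l y)=(x\,\underline{\triangleright}^j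 z)\,\underline{\triangleright}^k (y\,\overline{\triangleright}^l z).$$ A homomorphism of mc-biquandles is a map preserving all four operations; an isomorphism is a bijective homomorphism. **Diagrams.** Two diagrams of oriented classical links represent the same link iff they are related by planar isotopy and oriented Reidemeister moves I, II, III; for virtual link diagrams one also allows the virtual moves (detour moves). A classical (non-virtual) crossing is single-component (type $s$) if both its strands belong to the same component of the link, and multi-component (type $m$) if they belong to different components. Semiarcs are the pieces obtained by cutting the diagram at all classical crossing points, on both the over- and the understrand (virtual crossings do not cut; a component with no classical crossing contributes one semiarc). **Crossing relations.** At a classical crossing of type $l\in\{s,m\}$, let $x$ be the semiarc of the understrand lying to the right of the oriented overstrand, $y$ the semiarc of the overstrand lying to the right of the oriented understrand, $x'$ the other understrand semiarc and $y'$ the other overstrand semiarc. The crossing relations are $x'=x\,\underline{\triangleright}^l y$ and $y'=y\,\overline{\triangleright}^l x$. (For a positive crossing $x$ is the incoming under-semiarc and $y$ the outgoing over-semiarc; for a negative crossing $x$ is the outgoing under-semiarc and $y$ the incoming over-semiarc.) Nothing is imposed at virtual crossings. **Fundamental mc-biquandle.** For a diagram $D$, $\mathcal{MCB}(D)$ is defined as follows. Take one generator for each semiarc of $D$. An mc-biquandle word is a generator or an expression of one of the forms $w\,\underline{\triangleright}^l w'$, $w\,\overline{\triangleright}^l w'$, $(\alpha^l_{w})^{-1}(w')$, $(\beta^l_{w})^{-1}(w')$, $(S^l)^{-1}_i(w,w')$, where $l\in\{s,m\}$, $i\in\{1,2\}$, $w,w'$ are mc-biquandle words, and $(S^l)^{-1}_i$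 denotes the $i$-th component of $(S^l)^{-1}$. The elements of $\mathcal{MCB}(D)$ are the equivalence classes of mc-biquandle words under the congruence generated by the mc-biquandle axioms and the crossing relations at all classical crossings of $D$. That is, $\mathcal{MCB}(D)$ is the mc-biquandle presented by the semiarc generators and the crossing relations. *)

(* Defs.v *)
From HB Require Import structures.
From Stdlib Require Export Relation_Operators.
From mathcomp Require Export all_boot all_fingroup.
From mathcomp Require Export boolp.

Set Implicit Arguments.
Unset Strict Implicit.
Unset Printing Implicit Defensive.

Local Open Scope quotient_scope.

Inductive crossing_type := single | multi.

(* The admissible triples (j, k, l) of the exchange laws: among three strands,
   the number of pairs lying on different components is never exactly one. *)
Definition admissible (j k l : crossing_type) : Prop :=
  match j, k, l with
  | single, single, single
  | single, multi, multi
  | multi, single, multi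
  | multi, multi, single
  | multi, multi, multi => True
  | _, _, _ => False
  end.

Definition switch (X : Type) (und ovr : crossing_type -> X -> X -> X)
    (j : crossing_type) (p : X * X) : X * X :=
  (ovr j p.2 p.1, und j p.1 p.2).

Record mcBiquandle : Type := McBiquandle {
  carrier :> Type;
  und : crossing_type -> carrier -> carrier -> carrier;
  ovr : crossing_type -> carrier -> carrier -> carrier;
  ovr_diag : forall x, ovr single x x = und single x x;
  und_bij : forall j y, bijective (fun x => und j x y);
  ovr_bij : forall j y, bijective (fun x => ovr j x y);
  switch_bij : forall j, bijective (switch und ovr j);
  exchange_oo : forall j k l, admissible j k l -> forall x y z,
    ovr l (ovr k x y) (ovr j z y) = ovr k (ovr l x z) (und j y z);
  exchange_uo : forall j k l, admissible j k l -> forall x y z,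
    ovr j (und l x y) (und k z y) = und l (ovr j x z) (ovr k y z);
  exchange_uu : forall j k l, admissible j k l -> forall x y z,
    und j (und k x y) (und l z y) = und k (und j x z) (ovr l y z)
}.

Definition mcb_hom (X Y : mcBiquandle) (f : X -> Y) : Prop :=
  (forall j x y, f (und j x y) = und j (f x) (f y)) /\
  (forall j x y, f (ovr j x y) = ovr j (f x) (f y)).

Definition mcb_isomorphic (X Y : mcBiquandle) : Prop :=
  exists f : X -> Y, mcb_hom f /\ bijective f.

(** * Presentations *)

(* [WUndInv l w w'] and [WOvrInv l w w'] stand for the inverses of
   [und l _ w] and [ovr l _ w] applied to w'; [WSw1 l w w'] and [WSw2 l w w']
   for the two components of the inverse of the switch map at (w, w'). *)
Inductive word (G : Type) : Type :=
  | Gen of G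
  | WUnd of crossing_type & word G & word G
  | WOvr of crossing_type & word G & word G
  | WUndInv of crossing_type & word G & word G
  | WOvrInv of crossing_type & word G & word G
  | WSw1 of crossing_type & word G & word G
  | WSw2 of crossing_type & word G & word G.

HB.instance Definition _ (G : Type) := gen_eqMixin (word G).
HB.instance Definition _ (G : Type) := gen_choiceMixin (word G).

Inductive cong (G : Type) (R : word G -> word G -> Prop) :
    word G -> word G -> Prop :=
  | cong_base w w' : R w w' -> cong R w w'
  | cong_refl w : cong R w w
  | cong_sym w w' : cong R w w' -> cong R w' w
  | cong_trans w w' w'' : cong R w w' -> cong R w' w'' -> cong R w w''
  | cong_und l a a' b b' : cong R a a' -> cong R b b' ->
      cong R (WUnd l a b) (WUnd l a' b')
  | cong_ovr l a a' b b' : cong R a a' -> cong R b b' ->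
      cong R (WOvr l a b) (WOvr l a' b')
  | cong_und_inv l a a' b b' : cong R a a' -> cong R b b' ->
      cong R (WUndInv l a b) (WUndInv l a' b')
  | cong_ovr_inv l a a' b b' : cong R a a' -> cong R b b' ->
      cong R (WOvrInv l a b) (WOvrInv l a' b')
  | cong_sw1 l a a' b b' : cong R a a' -> cong R b b' ->
      cong R (WSw1 l a b) (WSw1 l a' b')
  | cong_sw2 l a a' b b' : cong R a a' -> cong R b b' ->
      cong R (WSw2 l a b) (WSw2 l a' b')
  | cong_diag x : cong R (WOvr single x x) (WUnd single x x)
  | cong_undK l x y : cong R (WUndInv l y (WUnd l x y)) x
  | cong_undVK l x y : cong R (WUnd l (WUndInv l y x) y) x
  | cong_ovrK l x y : cong R (WOvrInv l y (WOvr l x y)) x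
  | cong_ovrVK l x y : cong R (WOvr l (WOvrInv l y x) y) x
  | cong_swK1 l x y : cong R (WSw1 l (WOvr l y x) (WUnd l x y)) x
  | cong_swK2 l x y : cong R (WSw2 l (WOvr l y x) (WUnd l x y)) y
  | cong_swVK1 l x y : cong R (WOvr l (WSw2 l x y) (WSw1 l x y)) x
  | cong_swVK2 l x y : cong R (WUnd l (WSw1 l x y) (WSw2 l x y)) y
  | cong_oo j k l x y z : admissible j k l ->
      cong R (WOvr l (WOvr k x y) (WOvr j z y))
             (WOvr k (WOvr l x z) (WUnd j y z))
  | cong_uo j k l x y z : admissible j k l ->
      cong R (WOvr j (WUnd l x y) (WUnd k z y))
             (WUnd l (WOvr j x z) (WOvr k y z))
  | cong_uu j k l x y z : admissible j k l ->
      cong R (WUnd j (WUnd k x y) (WUnd l z y))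
             (WUnd k (WUnd j x z) (WOvr l y z)).

Definition congb (G : Type) (R : word G -> word G -> Prop) : rel (word G) :=
  fun w w' => `[< cong R w w' >].

Lemma congb_equiv (G : Type) (R : word G -> word G -> Prop) :
  equiv_class_of (congb R).
Proof.
split.
- by move=> w; apply/asboolP/cong_refl.
- by move=> w w'; apply/asboolP/asboolP; apply: cong_sym.
- move=> w w' w'' /asboolP h /asboolP h'; apply/asboolP.
  exact: cong_trans h h'.
Qed.

Definition cong_equiv (G : Type) (R : word G -> word G -> Prop) :
  equiv_rel (word G) := EquivRelPack (congb_equiv R).

Definition presented_type (G : Type) (R : word G -> word G -> Prop) : Type :=
  {eq_quot cong_equiv R}.

Definition word_class (G : Type) (R : word G -> word G -> Prop) (w : word G) :
  presented_type R := \pi_({eq_quot cong_equiv R}) w.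

Definition class_repr (G : Type) (R : word G -> word G -> Prop)
  (a : presented_type R) : word G := generic_quotient.repr (a : {eq_quot cong_equiv R}).

Lemma word_classE (G : Type) (R : word G -> word G -> Prop) (w w' : word G) :
  word_class R w = word_class R w' <-> cong R w w'.
Proof.
split=> [/eqquotP /asboolP // | h]; apply/eqquotP; exact/asboolP.
Qed.

Lemma class_reprK (G : Type) (R : word G -> word G -> Prop)
  (a : presented_type R) : word_class R (class_repr a) = a.
Proof. exact: reprK. Qed.

Definition class_op (G : Type) (R : word G -> word G -> Prop)
    (op : word G -> word G -> word G) (a b : presented_type R) :
    presented_type R :=
  word_class R (op (class_repr a) (class_repr b)).

Lemma class_opE (G : Type) (R : word G -> word G -> Prop)
    (op : word G -> word G -> word G) :
  (forall a a' b b', cong R a a' -> cong R b b' ->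
     cong R (op a b) (op a' b')) ->
  forall w w', class_op op (word_class R w) (word_class R w') =
               word_class R (op w w').
Proof.
by move=> h w w'; apply/word_classE; apply: h; apply/word_classE;
  rewrite class_reprK.
Qed.

Lemma class_ind (G : Type) (R : word G -> word G -> Prop)
    (P : presented_type R -> Prop) :
  (forall w, P (word_class R w)) -> forall a, P a.
Proof. by move=> h a; rewrite -(class_reprK a). Qed.

Definition presented_und (G : Type) (R : word G -> word G -> Prop)
  (l : crossing_type) : presented_type R -> presented_type R -> presented_type R :=
  class_op (@WUnd G l).

Definition presented_ovr (G : Type) (R : word G -> word G -> Prop)
  (l : crossing_type) : presented_type R -> presented_type R -> presented_type R :=
  class_op (@WOvr G l).

Lemma presented_undE (G : Type) (R : word G -> word G -> Prop) l w w' :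
  presented_und l (word_class R w) (word_class R w') = word_class R (WUnd l w w').
Proof. by apply: class_opE => *; apply: cong_und. Qed.

Lemma presented_ovrE (G : Type) (R : word G -> word G -> Prop) l w w' :
  presented_ovr l (word_class R w) (word_class R w') = word_class R (WOvr l w w').
Proof. by apply: class_opE => *; apply: cong_ovr. Qed.

Lemma presented_diag (G : Type) (R : word G -> word G -> Prop)
  (a : presented_type R) : presented_ovr single a a = presented_und single a a.
Proof.
elim/class_ind: a => w; rewrite presented_undE presented_ovrE.
exact/word_classE/cong_diag.
Qed.

Lemma presented_und_bij (G : Type) (R : word G -> word G -> Prop) l
  (b : presented_type R) : bijective (fun a => presented_und l a b).
Proof.
exists (fun a => class_op (@WUndInv G l) b a); elim/class_ind: b => w'.
- elim/class_ind=> w; rewrite presented_undE class_opE.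
    exact/word_classE/cong_undK.
  by move=> *; apply: cong_und_inv.
- elim/class_ind=> w; rewrite class_opE ?presented_undE.
    exact/word_classE/cong_undVK.
  by move=> *; apply: cong_und_inv.
Qed.

Lemma presented_ovr_bij (G : Type) (R : word G -> word G -> Prop) l
  (b : presented_type R) : bijective (fun a => presented_ovr l a b).
Proof.
exists (fun a => class_op (@WOvrInv G l) b a); elim/class_ind: b => w'.
- elim/class_ind=> w; rewrite presented_ovrE class_opE.
    exact/word_classE/cong_ovrK.
  by move=> *; apply: cong_ovr_inv.
- elim/class_ind=> w; rewrite class_opE ?presented_ovrE.
    exact/word_classE/cong_ovrVK.
  by move=> *; apply: cong_ovr_inv.
Qed.

Lemma presented_switch_bij (G : Type) (R : word G -> word G -> Prop) l :
  bijective (switch (@presented_und G R) (@presented_ovr G R) l).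
Proof.
have sw1E := class_opE (@cong_sw1 G R l).
have sw2E := class_opE (@cong_sw2 G R l).
exists (fun p => (class_op (@WSw1 G l) p.1 p.2, class_op (@WSw2 G l) p.1 p.2)).
- case=> a b; elim/class_ind: a => x; elim/class_ind: b => y.
  rewrite /switch /= presented_undE presented_ovrE sw1E sw2E.
  by congr (_, _); apply/word_classE; [apply: cong_swK1 | apply: cong_swK2].
- case=> a b; elim/class_ind: a => x; elim/class_ind: b => y.
  rewrite /switch /= sw1E sw2E presented_undE presented_ovrE.
  by congr (_, _); apply/word_classE; [apply: cong_swVK1 | apply: cong_swVK2].
Qed.

Lemma presented_oo (G : Type) (R : word G -> word G -> Prop) j k l :
  admissible j k l -> forall x y z : presented_type R,
  presented_ovr l (presented_ovr k x y) (presented_ovr j z y) =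
  presented_ovr k (presented_ovr l x z) (presented_und j y z).
Proof.
move=> h x y z; elim/class_ind: x => x; elim/class_ind: y => y.
elim/class_ind: z => z; rewrite !(presented_undE, presented_ovrE).
exact/word_classE/cong_oo.
Qed.

Lemma presented_uo (G : Type) (R : word G -> word G -> Prop) j k l :
  admissible j k l -> forall x y z : presented_type R,
  presented_ovr j (presented_und l x y) (presented_und k z y) =
  presented_und l (presented_ovr j x z) (presented_ovr k y z).
Proof.
move=> h x y z; elim/class_ind: x => x; elim/class_ind: y => y.
elim/class_ind: z => z; rewrite !(presented_undE, presented_ovrE).
exact/word_classE/cong_uo.
Qed.

Lemma presented_uu (G : Type) (R : word G -> word G -> Prop) j k l :
  admissible j k l -> forall x y z : presented_type R,
  presented_und j (presented_und k x y) (presented_und l z y) =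
  presented_und k (presented_und j x z) (presented_ovr l y z).
Proof.
move=> h x y z; elim/class_ind: x => x; elim/class_ind: y => y.
elim/class_ind: z => z; rewrite !(presented_undE, presented_ovrE).
exact/word_classE/cong_uu.
Qed.

(* The mc-biquandle presented by the generators G and the relations R. *)
Definition presented (G : Type) (R : word G -> word G -> Prop) : mcBiquandle :=
  McBiquandle (@presented_diag G R) (@presented_und_bij G R)
    (@presented_ovr_bij G R) (@presented_switch_bij G R)
    (@presented_oo G R) (@presented_uo G R) (@presented_uu G R).

(** * Link diagrams *)

(* Every transverse crossing of two oriented strands can be rotated so that
   both strands point upwards:

        NW   NE
          \ /          strand [false] runs from SW to NE,
           X           strand [true]  runs from SE to NW.
          / \
        SW   SE

   The crossing is positive when the SW-NE strand is the overstrand, negative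
   when the SE-NW strand is. *)
Inductive crossing_kind := Positive | Negative | Virtual.

(* A diagram up to isotopy is a plane map: the finite set of its crossings and,
   for each passage (crossing, strand), the next passage met when following the
   orientation of the link.  The number of circles without any crossing is
   recorded separately.  Neither the unbounded face nor the face in which each
   connected piece of the diagram lies is recorded: changing them amounts to a
   sequence of the moves defined below (classical moves if the diagram is
   classical, detours otherwise), so no link is identified with another. *)
Record diagram_code : Type := DiagramCode {
  crossing : finType;
  kind : crossing -> crossing_kind;
  next : {perm crossing * bool};
  circles : nat
}.

Definition passage (D : diagram_code) : finType := (crossing D * bool)%type.

Definition is_virtual (D : diagram_code) (c : crossing D) : bool :=
  if kind c is Virtual then true else false.

Inductive height := Upper | Lower | Flat.

Definition height_of (D : diagram_code) (p : passage D) : height :=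
  match kind p.1, p.2 with
  | Virtual, _ => Flat
  | Positive, false | Negative, true => Upper
  | Positive, true | Negative, false => Lower
  end.

(* The edges of the underlying 4-valent plane graph: [inl p] is the edge
   leading into the passage p, [inr i] is a circle without crossings. *)
Definition edge (D : diagram_code) : finType :=
  (passage D + 'I_(circles D))%type.

Definition edge_in (D : diagram_code) (p : passage D) : edge D := inl p.
Definition edge_out (D : diagram_code) (p : passage D) : edge D :=
  inl (next D p).

(* Two edges are fused by K when they belong to the same arc once the curve is
   no longer cut at the crossings of K. *)
Definition fused (D : diagram_code) (K : {set crossing D}) : rel (edge D) :=
  connect [rel e e' | [exists p : passage D, (p.1 \in K) &&
     ((e == edge_in p) && (e' == edge_out p) ||
      (e == edge_out p) && (e' == edge_in p))]].

(* A dart is an end of an edge at a crossing: ((c, s), o) is the end at c of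
   the outgoing (o = true) or incoming (o = false) half of the strand s. *)
Definition dart (D : diagram_code) : finType := (passage D * bool)%type.

(* The next dart counterclockwise around the crossing:
   SE -> NE -> NW -> SW -> SE. *)
Definition turn (D : diagram_code) (d : dart D) : dart D :=
  match d with
  | ((c, true), false) => ((c, false), true)
  | ((c, false), true) => ((c, true), true)
  | ((c, true), true) => ((c, false), false)
  | ((c, false), false) => ((c, true), false)
  end.

Definition opposite (D : diagram_code) (d : dart D) : dart D :=
  if d.2 then (next D d.1, false) else ((next D)^-1%g d.1, true).

(* The orbits of [face] are the boundary walks of the faces. *)
Definition face (D : diagram_code) (d : dart D) : dart D := turn (opposite d).

(* Euler's formula V - E + F = 2 K, with E = 2 V as the graph is 4-valent and
   with K the number of connected components of the graph. *)
Definition planar (D : diagram_code) : Prop :=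
  fcard (@face D) predT =
  #|crossing D| +
  2 * n_comp [rel d d' : dart D | (d' == turn d) || (d' == opposite d)] predT.

Record diagram : Type := Diagram {
  code :> diagram_code;
  code_planar : planar code
}.

Definition is_classical (D : diagram_code) : Prop :=
  forall c : crossing D, ~~ is_virtual c.

(** * Reidemeister moves *)

Definition planar_isotopic (D D' : diagram_code) : Prop :=
  circles D = circles D' /\
  exists f : crossing D -> crossing D',
    [/\ bijective f,
        forall c, kind (f c) = kind c &
        forall p, next D' (f p.1, p.2) = (f (next D p).1, (next D p).2)].

(* D' is obtained from D by removing the crossings of K, both strands through
   each of them being kept and joined up: the edges of D' are the classes of
   edges of D fused by K. *)
Definition removes (D : diagram_code) (K : {set crossing D})
    (D' : diagram_code) : Prop :=
  exists (f : crossing D' -> crossing D) (g : edge D -> edge D'),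
    [/\ injective f,
        forall c, c \notin K <-> exists c', f c' = c &
        forall c', kind (f c') = kind c'] /\
    [/\ forall e', exists e, g e = e',
        forall e1 e2, g e1 = g e2 <-> fused K e1 e2,
        forall p : passage D', g (edge_in (D := D) (f p.1, p.2)) = edge_in p &
        forall p : passage D', g (edge_out (D := D) (f p.1, p.2)) = edge_out p].

(* Removal of a kink: one of its two loop edges bounds a monogon.  This is the
   first Reidemeister move or its virtual analogue, in all oriented versions. *)
Definition move1 (D D' : diagram_code) : Prop :=
  exists2 d : dart D, face d = d & removes [set d.1.1] D'.

(* Removal of a bigon whose two sides run one above the other, or whose two
   crossings are virtual.  It suffices to compare the heights of one of the
   sides. *)
Definition move2 (D D' : diagram_code) : Prop :=
  exists d1 d2 : dart D,
    [/\ face d1 = d2, face d2 = d1, d1.1.1 != d2.1.1,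
        height_of d1.1 = height_of (opposite d1).1 &
        removes [set d1.1.1; d2.1.1] D'].

(* The strand containing the edge of d has height h at both ends of it. *)
Definition side_height (D : diagram_code) (h : height) (d : dart D) : Prop :=
  height_of d.1 = h /\ height_of (opposite d).1 = h.

(* Sliding a strand of a triangle across the opposite corner: each of the three
   strands meets its two crossings in the reverse order, so that the two
   passages joined by each side of the triangle exchange their places.  Either
   one strand is above and another one below the rest (third Reidemeister move)
   or one strand has only virtual crossings (purely virtual and mixed moves).
   The moves with two classical and one virtual crossing are forbidden. *)
Definition move3 (D D' : diagram_code) : Prop :=
  exists d1 d2 d3 : dart D,
    [/\ face d1 = d2, face d2 = d3, face d3 = d1,
        uniq [:: d1.1.1; d2.1.1; d3.1.1] &
        let sides h := [\/ side_height h d1, side_height h d2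
                         | side_height h d3] in
        (sides Upper /\ sides Lower) \/ sides Flat] /\
    let swap d : {perm passage D} := tperm d.1 (opposite d).1 in
    planar_isotopic
      (DiagramCode (@kind D) (next D ^ (swap d1 * swap d2 * swap d3))%g
         (circles D))
      D'.

Definition move (D D' : diagram_code) : Prop :=
  [\/ planar_isotopic D D', move1 D D', move2 D D' | move3 D D'].

Inductive link_theory := ClassicalLinks | VirtualLinks.

Definition allowed (t : link_theory) (D : diagram) : Prop :=
  if t is ClassicalLinks then is_classical D else True.

(* A step between classical diagrams involves classical crossings only.  For
   virtual links, detour moves are the composites of the moves above that
   involve virtual crossings. *)
Definition same_link (t : link_theory) : diagram -> diagram -> Prop :=
  clos_refl_sym_trans diagram
    (fun D D' => [/\ allowed t D, allowed t D' & move D D']).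

(** * The fundamental mc-biquandle *)

Definition type_of (D : diagram_code) (c : crossing D) : crossing_type :=
  if (c, true) \in porbit (next D) (c, false) then single else multi.

Definition semiarc_set (D : diagram_code) (e : edge D) : {set edge D} :=
  [set e' | fused [set c | is_virtual c] e e'].

Definition semiarc (D : diagram_code) : finType :=
  {A : {set edge D} | A \in [set semiarc_set e | e in predT]}.

Definition semiarc_of (D : diagram_code) (e : edge D) : semiarc D :=
  Sub (semiarc_set e) (imset_f (@semiarc_set D) (erefl : e \in predT)).

Definition over_strand (D : diagram_code) (c : crossing D) : bool :=
  if kind c is Negative then true else false.

Definition gen_in (D : diagram_code) (p : passage D) : word (semiarc D) :=
  Gen (semiarc_of (edge_in p)).
Definition gen_out (D : diagram_code) (p : passage D) : word (semiarc D) :=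
  Gen (semiarc_of (edge_out p)).

Definition is_positive (D : diagram_code) (c : crossing D) : bool :=
  if kind c is Positive then true else false.

(* Half-strands of a classical crossing c: the understrand on the right and on
   the left of the overstrand, the overstrand on the right and on the left of
   the understrand. *)
Definition under_right (D : diagram_code) (c : crossing D) :=
  if is_positive c then gen_in (c, ~~ over_strand c)
  else gen_out (c, ~~ over_strand c).
Definition under_left (D : diagram_code) (c : crossing D) :=
  if is_positive c then gen_out (c, ~~ over_strand c)
  else gen_in (c, ~~ over_strand c).
Definition over_right (D : diagram_code) (c : crossing D) :=
  if is_positive c then gen_out (c, over_strand c)
  else gen_in (c, over_strand c).
Definition over_left (D : diagram_code) (c : crossing D) :=
  if is_positive c then gen_in (c, over_strand c)
  else gen_out (c, over_strand c).

Inductive crossing_relation (D : diagram_code) :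
    word (semiarc D) -> word (semiarc D) -> Prop :=
  | under_relation c : ~~ is_virtual c -> crossing_relation
      (under_left c) (WUnd (type_of c) (under_right c) (over_right c))
  | over_relation c : ~~ is_virtual c -> crossing_relation
      (over_left c) (WOvr (type_of c) (over_right c) (under_right c)).

Definition MCB (D : diagram_code) : mcBiquandle :=
  presented (@crossing_relation D).

(* Main.v *)
Require Import Defs.

(* Colour the edges of a diagram by the elements of an mc-biquandle X, subject to
   the crossing relations.  The fundamental mc-biquandle represents the functor
   sending X to the set of colourings, so it suffices to show that, for every X
   and every move, each colouring of one diagram agrees with exactly one
   colouring of the other on the edges that the move leaves in place.  This is a
   local statement about the one, two or three sides of the region being
   removed or turned over: the kink uses that x |-> x und x is bijective, the
   bigon only the invertibility axioms, and the triangle the exchange laws. *)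

Set Implicit Arguments.
Unset Strict Implicit.
Unset Printing Implicit Defensive.

(** Colours live on edges rather than on semiarcs, so a virtual crossing is a crossing like any
    other, whose law copies colours, and the moves with virtual crossings fit the same local
    statements. The types [single] and [multi] are the only non-local data. They are read off the
    orbits of [next], so every move has to be shown to preserve components, and the axioms fit the
    outcome: the crossing of a kink is [single], the two crossings of a bigon have one type, and
    being on the same component is transitive, which leaves only admissible triples for a triangle.
    Rotating the triangle and passing to the dual mc-biquandle, where over and under trade places,
    leave one arrangement of classical heights, to be checked in eight orientations. *)

Lemma mcb_isomorphic_refl (X : mcBiquandle) : mcb_isomorphic X X.
Proof. by exists id; split=> //; exists id. Qed.

Lemma mcb_isomorphic_sym (X Y : mcBiquandle) :
  mcb_isomorphic X Y -> mcb_isomorphic Y X.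
Proof.
case=> f [[fu fo] [g fK gK]]; exists g; split; last by exists f.
by split=> j x y; apply: (can_inj fK); rewrite (fu, fo) !gK.
Qed.

Lemma mcb_isomorphic_trans (Y X Z : mcBiquandle) :
  mcb_isomorphic X Y -> mcb_isomorphic Y Z -> mcb_isomorphic X Z.
Proof.
case=> f [[fu fo] fb] [g [[gu go] gb]]; exists (g \o f).
by split; [split=> j x y /=; rewrite ?fu ?fo ?gu ?go | apply: bij_comp].
Qed.

(** * Consequences of the mc-biquandle axioms *)

Section McBiquandleTheory.
Variable X : mcBiquandle.
Implicit Types (x y z : X) (l : crossing_type).

Lemma und_inj l y x x' : und l x y = und l x' y -> x = x'.
Proof. exact: (bij_inj (und_bij l y)). Qed.

Lemma ovr_inj l y x x' : ovr l x y = ovr l x' y -> x = x'.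
Proof. exact: (bij_inj (ovr_bij l y)). Qed.

Lemma und_surj l y x : exists z, x = und l z y.
Proof. by case: (und_bij l y) => g _ gK; exists (g x); rewrite gK. Qed.

Lemma ovr_surj l y x : exists z, x = ovr l z y.
Proof. by case: (ovr_bij l y) => g _ gK; exists (g x); rewrite gK. Qed.

Lemma switch_inj l x y x' y' :
  ovr l y x = ovr l y' x' -> und l x y = und l x' y' -> x = x' /\ y = y'.
Proof.
move=> eo eu.
have : switch (@und X) (@ovr X) l (x, y) = switch (@und X) (@ovr X) l (x', y').
  by rewrite /switch /= eo eu.
by move/(bij_inj (switch_bij X l)) => [].
Qed.

Lemma switch_surj l u v : exists x y, u = ovr l y x /\ v = und l x y.
Proof.
case: (switch_bij X l) => g _ gK; exists (g (u, v)).1, (g (u, v)).2.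
by have [e1 e2] := gK (u, v); split; apply: esym.
Qed.

(* The switch sends (x, y) to the diagonal only if x = y: the exchange law
   with z = x reads (x und x) und a = a und a, so the diagonal point (x, x) has
   the same image (a, a). *)
Lemma switch_diag x y :
  und single x y = ovr single y x -> x = y /\ und single x x = und single x y.
Proof.
move=> e; have ex := @exchange_uu X single single single I x y x.
rewrite -e in ex; have exx := und_inj ex.
by have [] := @switch_inj single x x x y; rewrite ?ovr_diag -?e.
Qed.

Lemma und_diag_surj x : exists z, x = und single z z.
Proof.
have [z [y [e1 e2]]] := switch_surj single x x.
by have [_ e] := @switch_diag z y (etrans (esym e2) e1); exists z; rewrite e.
Qed.

Lemma und_diag_inj x y : und single x x = und single y y -> x = y.
Proof. by move=> e; have [] := @switch_inj single x x y y; rewrite ?ovr_diag. Qed.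

End McBiquandleTheory.

(** * Symmetries of the axioms and the law at one crossing *)

Lemma admissible_rot j k l : admissible j k l -> admissible k l j.
Proof. by case: j; case: k; case: l. Qed.

Lemma admissible_flip j k l : admissible j k l -> admissible l k j.
Proof. by case: j; case: k; case: l. Qed.

(* Exchanging the two operations reverses the sign of the crossings. *)
Definition dual (X : mcBiquandle) : mcBiquandle.
refine (@McBiquandle X (@ovr X) (@und X) _ (@ovr_bij X) (@und_bij X) _ _ _ _).
- by move=> x; rewrite ovr_diag.
(* The switch of the dual is the original switch conjugated by the exchange of the two factors. *)
- move=> j; apply: (@eq_bij _ _
    ((fun p => (p.2, p.1)) \o switch (@und X) (@ovr X) j \o (fun p => (p.2, p.1)))).
    apply: bij_comp; last by exists (fun p => (p.2, p.1)) => -[].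
    by apply: bij_comp (switch_bij X j); exists (fun p => (p.2, p.1)) => -[].
  by case.
(* Exchanging the operations swaps the first and third exchange laws and turns the second one
   around, provided [j] and [l] trade places. *)
- by move=> j k l /admissible_flip h x y z; rewrite (exchange_uu h).
- by move=> j k l /admissible_flip h x y z; rewrite -(exchange_uo h).
- by move=> j k l /admissible_flip h x y z; rewrite (exchange_oo h).
Defined.

(* [p] and [q] are the pairs of the incoming and the outgoing colour of the
   strand [s] of the crossing and of its other strand. *)
Definition crossing_law (X : mcBiquandle) (k : crossing_kind) (l : crossing_type)
    (s : bool) (p q : X * X) : Prop :=
  let t := if s then p else q in
  let f := if s then q else p in
  match k with
  | Positive => t.2 = und l t.1 f.2 /\ f.1 = ovr l f.2 t.1
  | Negative => f.1 = und l f.2 t.1 /\ t.2 = ovr l t.1 f.2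
  | Virtual => f.1 = f.2 /\ t.1 = t.2
  end.

Lemma crossing_lawC (X : mcBiquandle) k l s (p q : X * X) :
  crossing_law k l (~~ s) p q <-> crossing_law k l s q p.
Proof. by case: s. Qed.

Definition ends (A : Type) (D : diagram_code) (c : edge D -> A) (p : passage D) :
  A * A := (c (edge_in p), c (edge_out p)).

Definition coloring (D : diagram_code) (X : mcBiquandle) (c : edge D -> X) :=
  forall x s, crossing_law (kind x) (type_of x) s
    (ends c (x, s)) (ends c (x, ~~ s)).

(** The law at a crossing is symmetric in its strands. Hence each corner of a region may be checked
    from the strand on which the boundary walk enters it. *)
Lemma coloringP (D : diagram_code) (X : mcBiquandle) (c : edge D -> X) x s :
  crossing_law (kind x) (type_of x) s (ends c (x, s)) (ends c (x, ~~ s)) ->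
  forall s', crossing_law (kind x) (type_of x) s' (ends c (x, s')) (ends c (x, ~~ s')).
Proof. by move=> h s'; case: s h; case: s' => //= /crossing_lawC. Qed.

(** * The universal colouring by the fundamental mc-biquandle *)

Section Universal.
Variable D : diagram_code.

Definition generic_color (e : edge D) : MCB D :=
  word_class (@crossing_relation D) (Gen (semiarc_of e)).

Lemma fused_sym (K : {set crossing D}) : connect_sym
  [rel e e' : edge D | [exists p : passage D, (p.1 \in K) &&
     ((e == edge_in p) && (e' == edge_out p) ||
      (e == edge_out p) && (e' == edge_in p))]].
Proof.
apply: sym_connect_sym => e e' /=; apply: eq_existsb => p.
by rewrite orbC ![(e == _) && _]andbC.
Qed.

Lemma fused_in_out (K : {set crossing D}) (p : passage D) :
  p.1 \in K -> fused K (edge_in p) (edge_out p).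
Proof. by move=> pK; apply/connect1/existsP; exists p; rewrite pK !eqxx. Qed.

Lemma fused_const (K : {set crossing D}) (A : Type) (v : edge D -> A) :
  (forall p : passage D, p.1 \in K -> v (edge_in p) = v (edge_out p)) ->
  forall e e', fused K e e' -> v e = v e'.
Proof.
move=> h e e' /connectP [es]; elim: es e => /= [e _ -> //|e1 es IH e].
case/andP=> /existsP [p /andP[pK he]] pth lst; rewrite -(IH e1) //.
by case/orP: he => /andP[/eqP-> /eqP->]; rewrite (h p).
Qed.

Lemma eq_semiarc_of (e e' : edge D) :
  semiarc_of e = semiarc_of e' <-> fused [set c | is_virtual c] e e'.
Proof.
split=> [/(congr1 val) /= E | ee'].
  have : e' \in semiarc_set e' by rewrite inE /fused connect0.
  by rewrite -E inE.
apply: val_inj => /=; apply/setP=> e1; rewrite !inE /fused.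
exact: (same_connect (@fused_sym _)).
Qed.

Lemma generic_coloring : coloring generic_color.
Proof.
move=> x; apply: (@coloringP _ _ _ _ false).
rewrite /crossing_law /ends /=.
case kx: (kind x).
- have nv : ~~ is_virtual x by rewrite /is_virtual kx.
  have := under_relation nv; have := over_relation nv.
  rewrite /under_left /over_left /under_right /over_right /is_positive.
  rewrite /over_strand kx /= => o u.
  by split; rewrite /= /generic_color ?presented_undE ?presented_ovrE;
    apply/word_classE/cong_base.
- have nv : ~~ is_virtual x by rewrite /is_virtual kx.
  have := under_relation nv; have := over_relation nv.
  rewrite /under_left /over_left /under_right /over_right /is_positive.
  rewrite /over_strand kx /= => o u.
  by split; rewrite /= /generic_color ?presented_undE ?presented_ovrE;
    apply/word_classE/cong_base.
- have vx : x \in [set c : crossing D | is_virtual c] by rewrite inE /is_virtual kx.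
  by split; congr (word_class _ (Gen _)); apply/eq_semiarc_of/fused_in_out.
Qed.

Lemma coloring_comp (X Y : mcBiquandle) (h : X -> Y) (c : edge D -> X) :
  mcb_hom h -> coloring c -> coloring (h \o c).
Proof.
case=> hu ho cc x s; have := cc x s; rewrite /crossing_law /ends /=.
by case: (kind x); case: s => /= -[e1 e2]; rewrite -?hu -?ho; split; congr h.
Qed.

Section Eval.
Variables (X : mcBiquandle) (G : Type) (v : G -> X).

(** An [mcBiquandle] records bijectivity but no inverse operations, so formal inverses are evaluated
    by chosen solutions; injectivity makes the choice immaterial. *)
Fixpoint eval (w : word G) : X :=
  match w with
  | Gen g => v g
  | WUnd l a b => und l (eval a) (eval b)
  | WOvr l a b => ovr l (eval a) (eval b)
  | WUndInv l a b => sval (cid (und_surj l (eval a) (eval b)))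
  | WOvrInv l a b => sval (cid (ovr_surj l (eval a) (eval b)))
  | WSw1 l a b => sval (cid (switch_surj l (eval a) (eval b)))
  | WSw2 l a b => sval (cid (svalP (cid (switch_surj l (eval a) (eval b)))))
  end.

Lemma eval_sw l a b : eval a = ovr l (eval (WSw2 l a b)) (eval (WSw1 l a b)) /\
  eval b = und l (eval (WSw1 l a b)) (eval (WSw2 l a b)).
Proof. by rewrite /=; case: cid => x h /=; case: cid. Qed.

Lemma eval_cong (R : word G -> word G -> Prop) :
  (forall w w', R w w' -> eval w = eval w') ->
  forall w w', cong R w w' -> eval w = eval w'.
Proof.
move=> hR w w'; elim=> {w w'}; try by move=> *; rewrite /= ; congruence.
- exact: hR.
- by move=> /= l a a' b b' _ -> _ ->.
- by move=> /= l a a' b b' _ -> _ ->.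
- by move=> /= l a a' b b' _ -> _ ->.
- by move=> /= l a a' b b' _ -> _ ->.
- by move=> x; rewrite /= ovr_diag.
- by move=> l x y /=; case: cid => z /= /und_inj.
- by move=> l x y /=; case: cid.
- by move=> l x y /=; case: cid => z /= /ovr_inj.
- by move=> l x y /=; case: cid.
- move=> l x y; have [e1 e2] := eval_sw l (WOvr l y x) (WUnd l x y).
  by have [] := switch_inj e1 e2.
- move=> l x y; have [e1 e2] := eval_sw l (WOvr l y x) (WUnd l x y).
  by have [] := switch_inj e1 e2.
- by move=> l x y; have [] := eval_sw l x y.
- by move=> l x y; have [] := eval_sw l x y.
- by move=> j k l x y z h /=; rewrite (exchange_oo h).
- by move=> j k l x y z h /=; rewrite (exchange_uo h).
- by move=> j k l x y z h /=; rewrite (exchange_uu h).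
Qed.

End Eval.

Lemma coloring_factors (X : mcBiquandle) (c : edge D -> X) : coloring c ->
  exists h : MCB D -> X, mcb_hom h /\ forall e, h (generic_color e) = c e.
Proof.
move=> cc.
have semiE (g : semiarc D) : exists e, semiarc_of e = g.
  by case: g => A hA; have [e _ E] := imsetP hA; exists e; apply: val_inj.
(* A semiarc takes the colour of any of its edges: the law at a virtual crossing makes [c] constant
   along it. *)
pose v g := c (sval (cid (semiE g))).
have vE e : v (semiarc_of e) = c e.
  rewrite /v; case: cid => e' /= /eq_semiarc_of; apply: fused_const => -[x s].
  rewrite inE /is_virtual /= => vx; have := cc x s; rewrite /crossing_law /ends.
  by case: (kind x) vx => // _; case: s => -[].
have evR w w' : crossing_relation w w' -> eval v w = eval v w'.
  case=> x nv; have := cc x false; move: nv;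
    rewrite /under_left /over_left /under_right /over_right /is_positive;
    rewrite /over_strand /is_virtual /crossing_law /ends;
    by case: (kind x) => //= _; rewrite !vE => -[].
have evE a : eval v (class_repr (word_class (@crossing_relation D) a)) = eval v a.
  by apply: (eval_cong evR); apply/word_classE; rewrite class_reprK.
exists (fun a => eval v (class_repr a)); split; last by move=> e; rewrite evE /= vE.
by split=> j; elim/class_ind=> a; elim/class_ind=> b;
  rewrite /= ?presented_undE ?presented_ovrE !evE.
Qed.

(** Words also contain formal inverses; homomorphisms respect these because the operations that they
    invert are injective in the target. *)
Lemma hom_determined (X : mcBiquandle) (h h' : MCB D -> X) :
  mcb_hom h -> mcb_hom h' ->
  (forall e, h (generic_color e) = h' (generic_color e)) -> h =1 h'.
Proof.
move=> [hu ho] [hu' ho'] E; elim/class_ind.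
pose W w : MCB D := word_class (@crossing_relation D) w.
have WuE l a b : W (WUnd l a b) = und l (W a) (W b) by rewrite /= presented_undE.
have WoE l a b : W (WOvr l a b) = ovr l (W a) (W b) by rewrite /= presented_ovrE.
have Weq a b : cong (@crossing_relation D) a b -> W a = W b by move/word_classE.
have sw l a b : h (W a) = h' (W a) -> h (W b) = h' (W b) ->
    h (W (WSw1 l a b)) = h' (W (WSw1 l a b)) /\
    h (W (WSw2 l a b)) = h' (W (WSw2 l a b)).
  move=> ea eb; apply: (@switch_inj X l).
    by rewrite -ho -ho' -WoE (Weq _ _ (cong_swVK1 _ l a b)).
  by rewrite -hu -hu' -WuE (Weq _ _ (cong_swVK2 _ l a b)).
elim=> [g|l a IHa b IHb|l a IHa b IHb|l a IHa b IHb|l a IHa b IHb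
       |l a IHa b IHb|l a IHa b IHb]; rewrite -/(W _).
- case: g => A hA; have [e _ eA] := imsetP hA.
  suff -> : W (Gen (exist _ A hA : semiarc D)) = generic_color e by apply: E.
  by congr (word_class _ (Gen _)); apply: val_inj.
- by rewrite WuE hu hu' IHa IHb.
- by rewrite WoE ho ho' IHa IHb.
- apply: (@und_inj X l (h (W a))); rewrite {2}IHa -hu -hu' -WuE.
  by rewrite (Weq _ _ (cong_undVK _ l b a)).
- apply: (@ovr_inj X l (h (W a))); rewrite {2}IHa -ho -ho' -WoE.
  by rewrite (Weq _ _ (cong_ovrVK _ l b a)).
- by have [] := sw l a b IHa IHb.
- by have [] := sw l a b IHa IHb.
Qed.

End Universal.

(** * From agreeing colourings to isomorphic mc-biquandles *)

Definition agree (A B C : Type) (E : A -> B -> Prop) (c : A -> C) (c' : B -> C) :=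
  forall e e', E e e' -> c e = c' e'.

(* Yoneda: MCB represents colourings, and agreement on E is a natural relation. *)
Lemma mcb_isomorphic_agree (D D' : diagram_code) (E : edge D -> edge D' -> Prop) :
  (forall (X : mcBiquandle) (c : edge D -> X), coloring c ->
     exists c' : edge D' -> X, coloring c' /\ agree E c c') ->
  (forall (X : mcBiquandle) (c' : edge D' -> X), coloring c' ->
     exists c : edge D -> X, coloring c /\ agree E c c') ->
  (forall (X : mcBiquandle) (c1 c2 : edge D -> X) c', coloring c1 -> coloring c2 ->
     agree E c1 c' -> agree E c2 c' -> c1 =1 c2) ->
  (forall (X : mcBiquandle) (c1 c2 : edge D' -> X) c, coloring c1 -> coloring c2 ->
     agree E c c1 -> agree E c c2 -> c1 =1 c2) ->
  mcb_isomorphic (MCB D) (MCB D').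
Proof.
move=> fwd bwd uni uni'.
have [c' [cc' ac']] := fwd _ _ (@generic_coloring D).
have [c [cc ac]] := bwd _ _ (@generic_coloring D').
have [phi [hphi phiE]] := coloring_factors cc'.
have [psi [hpsi psiE]] := coloring_factors cc.
have hcomp (X Y Z : mcBiquandle) (f : Y -> Z) (g : X -> Y) :
    mcb_hom f -> mcb_hom g -> mcb_hom (f \o g).
  by case=> fu fo [gu go]; split=> j x y /=; rewrite ?gu ?go ?fu ?fo.
have hid (X : mcBiquandle) : mcb_hom (@id X) by split.
exists psi; split=> //; exists phi.
(* [phi \o psi] carries the generic colouring to [phi \o c]. Both colourings agree with [c'], so
   uniqueness identifies them. *)
- apply: (hom_determined (hcomp _ _ _ _ _ hphi hpsi) (hid _)) => e /=.
  rewrite psiE; apply: (uni _ (phi \o c) _ c') => //.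
  + exact: coloring_comp.
  + exact: generic_coloring.
  + by move=> e1 e2 /ac /= ->; rewrite phiE.
- apply: (hom_determined (hcomp _ _ _ _ _ hpsi hphi) (hid _)) => e /=.
  rewrite phiE; apply: (uni' _ (psi \o c') _ c) => //.
  + exact: coloring_comp.
  + exact: generic_coloring.
  + by move=> e1 e2 /ac' /= <-; rewrite psiE.
Qed.

(* Walk along the boundary of a face, as [face] does.  A side runs with the walk
   if [o] holds and against it otherwise; its strand is coloured [a] before, [n]
   along and [b] after the side.  At the corner where the walk enters the side
   the strand has the two colours [side o a n b], at the corner where it leaves
   the side those of [side (~~ o) a n b].  The strand entered at a corner is
   strand [o' (+) o] of the crossing, where [o'] belongs to the previous side. *)
Definition side (A : Type) (o : bool) (a n b : A) : A * A :=
  if o then (a, n) else (n, b).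

(** * Solving the crossing laws around a monogon, a bigon and a triangle *)

Section LocalLaws.
Variable X : mcBiquandle.
Implicit Types (a b n : X) (k : crossing_kind) (l : crossing_type) (o : bool).

(** The walk enters and leaves the only side at the same crossing: the entered strand is [o (+) o],
    that is [false], and a strand meeting itself gives type [single]. *)
Definition kink_law k o a n b :=
  crossing_law k single false (side o a n b) (side (~~ o) a n b).

(** At a classical kink the loop carries either both arguments of the two operations, and then this
    is [ovr_diag], or both of their values, and then it is [switch_diag]. *)
Lemma kink_closed k o a n b : kink_law k o a n b -> a = b.
Proof.
rewrite /kink_law; case: k; case: o => /= -[]; try congruence.
- by move=> -> ->; rewrite ovr_diag.
- by move=> e1 e2; have [] := @switch_diag X a b; congruence.
- by move=> -> ->; rewrite ovr_diag.
- by move=> e1 e2; have [] := @switch_diag X b a; congruence.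
Qed.

Lemma kink_exists k o a : exists n, kink_law k o a n a.
Proof.
(* [n] serves when the loop carries the arguments of the operations, [und single a a] when it
   carries their values. *)
rewrite /kink_law; have [n en] := und_diag_surj a.
case: k; last by exists a; case: o.
all: case: o => /=.
all: try by exists n; rewrite ?ovr_diag.
all: by exists (und single a a); rewrite ?ovr_diag.
Qed.

Lemma kink_unique k o a n n' b : kink_law k o a n b -> kink_law k o a n' b -> n = n'.
Proof.
rewrite /kink_law; case: k; case: o => /= -[e1 e2] [e3 e4]; try congruence.
all: by apply: und_diag_inj; congruence.
Qed.

(** At a corner one half of each strand is a side and the other half is coloured from outside.
    Depending on which halves are known, the sides come from the operations, from the inverse of one
    of them, or from the inverse of the switch. *)
Lemma corner_exists k l o o' a b a' b' : exists n n',
  crossing_law k l (o' (+) o) (side o a n b) (side (~~ o') a' n' b').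
Proof.
case: k; last by exists (if o then a else b), (if o' then b' else a'); case: o; case: o'.
all: case: o; case: o'; rewrite /crossing_law /=.
all: try by do 2 eexists.
- by have [x [y [? ?]]] := switch_surj l a b'; exists y, x.
- by have [x ?] := ovr_surj l a a'; exists (und l a x), x.
- by have [x ?] := und_surj l b' b; exists x, (ovr l b' x).
- by have [x [y [? ?]]] := switch_surj l b' a; exists x, y.
- by have [x ?] := und_surj l a a'; exists (ovr l a x), x.
- by have [x ?] := ovr_surj l b' b; exists x, (und l b' x).
Qed.

Lemma corner_unique k l o o' a n b a' n' b' m m' :
  crossing_law k l (o' (+) o) (side o a n b) (side (~~ o') a' n' b') ->
  crossing_law k l (o' (+) o) (side o a m b) (side (~~ o') a' m' b') ->
  n = m /\ n' = m'.
Proof.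
case: k; case: o; case: o' => /= -[e1 e2] [e3 e4]; try by split; congruence.
all: first
 [ have e : n = m by [apply: (@und_inj X l a'); congruence]
 | have e : n = m by [apply: (@und_inj X l b'); congruence]
 | have e : n = m by [apply: (@ovr_inj X l a'); congruence]
 | have e : n = m by [apply: (@ovr_inj X l b'); congruence]
 | have e : n' = m' by [apply: (@und_inj X l a); congruence]
 | have e : n' = m' by [apply: (@und_inj X l b); congruence]
 | have e : n' = m' by [apply: (@ovr_inj X l a); congruence]
 | have e : n' = m' by [apply: (@ovr_inj X l b); congruence]
 | have [| | e e'] := @switch_inj X l n n' m m'; [congruence|congruence|]
 | have [| | e e'] := @switch_inj X l n' n m' m; [congruence|congruence|] ];
 split; congruence.
Qed.

(** One type [l] serves both crossings, since the same two strands meet there. *)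
Definition bigon_law k1 k2 l o1 o2 a1 n1 b1 a2 n2 b2 :=
  crossing_law k1 l (o2 (+) o1) (side o1 a1 n1 b1) (side (~~ o2) a2 n2 b2) /\
  crossing_law k2 l (o1 (+) o2) (side o2 a2 n2 b2) (side (~~ o1) a1 n1 b1).

Definition opposite_kind k :=
  match k with Positive => Negative | Negative => Positive | Virtual => Virtual end.

(** With opposite kinds, the second law is the first one with [a1], [a2] and [b1], [b2] exchanged.
    Comparing the two and cancelling an operation or the switch identifies the outer colours. *)
Lemma bigon_closed k l o1 o2 a1 n1 b1 a2 n2 b2 :
  bigon_law k (opposite_kind k) l o1 o2 a1 n1 b1 a2 n2 b2 -> a1 = b1 /\ a2 = b2.
Proof.
rewrite /bigon_law; case: o1; case: o2; case: k => /= -[[e1 e2] [e3 e4]];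
  try by split; congruence.
all: first
 [ have e : a1 = b1 by [apply: (@und_inj X l n2); congruence]
 | have e : a1 = b1 by [apply: (@ovr_inj X l n2); congruence]
 | have e : a2 = b2 by [apply: (@und_inj X l n1); congruence]
 | have e : a2 = b2 by [apply: (@ovr_inj X l n1); congruence]
 | have [| | e e'] := @switch_inj X l a2 b1 b2 a1; [congruence|congruence|]
 | have [| | e e'] := @switch_inj X l b1 a2 a1 b2; [congruence|congruence|] ]; split; congruence.
Qed.

Lemma bigon_exists k l o1 o2 a1 a2 :
  exists n1 n2, bigon_law k (opposite_kind k) l o1 o2 a1 n1 a1 a2 n2 a2.
Proof.
(* When the outer colours are equal in pairs both laws coincide, so solving one corner is enough. *)
have [n1 [n2 h]] := corner_exists k l o1 o2 a1 a1 a2 a2.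
exists n1, n2; split=> //; move: h; case: o1; case: o2; case: k => /= -[e1 e2].
all: by split; congruence.
Qed.

Lemma bigon_unique k1 k2 l o1 o2 a1 n1 b1 a2 n2 b2 n1' n2' :
  bigon_law k1 k2 l o1 o2 a1 n1 b1 a2 n2 b2 ->
  bigon_law k1 k2 l o1 o2 a1 n1' b1 a2 n2' b2 -> n1 = n1' /\ n2 = n2'.
Proof. by case=> h _ [h' _]; apply: corner_unique h h'. Qed.


(* Reversing the order of the crossings on each strand amounts to negating
   [o1], [o2] and [o3]. *)
Definition triangle_law o1 o2 o3 k1 k2 k3 l1 l2 l3 a1 n1 b1 a2 n2 b2 a3 n3 b3 :=
  [/\ crossing_law k1 l1 (o3 (+) o1) (side o1 a1 n1 b1) (side (~~ o3) a3 n3 b3),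
      crossing_law k2 l2 (o1 (+) o2) (side o2 a2 n2 b2) (side (~~ o1) a1 n1 b1) &
      crossing_law k3 l3 (o2 (+) o3) (side o3 a3 n3 b3) (side (~~ o2) a2 n2 b2)].

Definition strand_height k (s : bool) : height :=
  match k, s with
  | Virtual, _ => Flat
  | Positive, false | Negative, true => Upper
  | Positive, true | Negative, false => Lower
  end.


(** One equation per strand: its colour after crossing the other two in either order. [T], [B], [M]
    belong to the top, bottom and middle strands; [l1] is the type of the crossing of top and
    middle, [l2] of top and bottom, [l3] of middle and bottom. *)
Lemma exchange_laws l1 l2 l3 (T B M : X) : admissible l1 l2 l3 ->
  [/\ ovr l1 (ovr l2 T B) (ovr l3 M B) = ovr l2 (ovr l1 T M) (und l3 B M),
      ovr l3 (und l1 M T) (und l2 B T) = und l1 (ovr l3 M B) (ovr l2 T B) &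
      und l3 (und l2 B T) (und l1 M T) = und l2 (und l3 B M) (ovr l1 T M)].
Proof.
move=> adm; split.
- by apply: exchange_oo; case: l1 l2 l3 adm => -[] [].
- by apply: exchange_uo; case: l1 l2 l3 adm => -[] [].
- by apply: exchange_uu; case: l1 l2 l3 adm => -[] [].
Qed.

(* Side 1 lies on the top strand and side 2 on the bottom one.  In each of the
   eight orientations, the exchange laws are applied to those colours of the top,
   bottom and middle strand that lie to the right of both other strands. *)
Lemma triangle_upper o1 o2 o3 k1 k2 k3 l1 l2 l3 a1 n1 b1 a2 n2 b2 a3 n3 b3 :
  admissible l1 l2 l3 ->
  strand_height k1 (o3 (+) o1) = Upper ->
  strand_height k2 (~~ (o1 (+) o2)) = Upper ->
  strand_height k3 (~~ (o2 (+) o3)) = Lower ->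
  triangle_law o1 o2 o3 k1 k2 k3 l1 l2 l3 a1 n1 b1 a2 n2 b2 a3 n3 b3 ->
  exists m1 m2 m3, triangle_law (~~ o1) (~~ o2) (~~ o3) k1 k2 k3 l1 l2 l3
    a1 m1 b1 a2 m2 b2 a3 m3 b3.
Proof.
move=> adm k1E k2E k3E; rewrite /triangle_law.
case: o1 k1E k2E; case: o2 k3E; case: o3; case: k1; case: k2 => //; case: k3 => //= _ _ _;
move=> [[e1 e2] [e3 e4] [e5 e6]].
- have [oo uo uu] := exchange_laws n1 n2 n3 adm.
  exists (ovr l1 b1 a3), (und l2 b2 a1), (und l1 a3 b1); split; split; congruence.
- have [oo uo uu] := exchange_laws a1 b2 n3 adm.
  exists (ovr l2 a1 b2), (und l2 b2 a1), (und l1 b3 (ovr l2 a1 b2)).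
  by split; split; congruence.
- have [oo uo uu] := exchange_laws b1 n2 a3 adm.
  exists (ovr l1 b1 a3), (und l3 b2 (und l1 a3 b1)), (und l1 a3 b1).
  by split; split; congruence.
(* The right-hand colour of the top strand is here a side of the turned triangle, hence not given.
   An inverse operation supplies it from one crossing, and cancelling in an exchange law yields its
   relation at the other. *)
- have [T Te] := ovr_surj l1 b3 b1.
  have [oo uo uu] := exchange_laws T a2 b3 adm.
  have Te' : a1 = ovr l2 T a2 by apply: (@ovr_inj X l1 n3); congruence.
  exists T, (und l2 a2 T), (und l1 b3 T); split; split; congruence.
- have [oo uo uu] := exchange_laws n1 a2 b3 adm.
  exists (ovr l1 a1 (ovr l3 b3 a2)), (und l3 a2 b3), (ovr l3 b3 a2).
  by split; split; congruence.
- have [B Be] := und_surj l3 a3 a2.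
  have [oo uo uu] := exchange_laws b1 B a3 adm.
  have Be' : b2 = und l2 B b1 by apply: (@und_inj X l3 n3); congruence.
  exists (ovr l2 b1 B), B, (ovr l3 a3 B); split; split; congruence.
- have [M Me] := ovr_surj l3 b2 b3.
  have [oo uo uu] := exchange_laws a1 b2 M adm.
  have Me' : a3 = und l1 M a1 by apply: (@ovr_inj X l3 n2); congruence.
  exists (ovr l1 a1 M), (und l3 b2 M), M; split; split; congruence.
(* All three right-hand colours are new: the inverse switch gives [B] and [M], an inverse operation
   gives [T], and injectivity of the same switch recovers [a2] and [b3]. *)
- have [B [M [Me Be]]] := switch_surj l3 a3 b2; have [T Te] := ovr_surj l1 M a1.
  have [oo uo uu] := exchange_laws T B M adm.
  have Te' : b1 = ovr l2 T B by apply: (@ovr_inj X l1 a3); congruence.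
  have [| |eB eM] := @switch_inj X l3 a2 b3 (und l2 B T) (und l1 M T); try congruence.
  exists T, B, M; split; split; congruence.
Qed.

Lemma triangle_rot o1 o2 o3 k1 k2 k3 l1 l2 l3 a1 n1 b1 a2 n2 b2 a3 n3 b3 :
  triangle_law o1 o2 o3 k1 k2 k3 l1 l2 l3 a1 n1 b1 a2 n2 b2 a3 n3 b3 ->
  triangle_law o2 o3 o1 k2 k3 k1 l2 l3 l1 a2 n2 b2 a3 n3 b3 a1 n1 b1.
Proof. by case. Qed.

Lemma triangle_flat o1 o2 o3 k3 l1 l2 l3 a1 n1 b1 a2 n2 b2 a3 n3 b3 :
  triangle_law o1 o2 o3 Virtual Virtual k3 l1 l2 l3 a1 n1 b1 a2 n2 b2 a3 n3 b3 ->
  exists m1 m2 m3, triangle_law (~~ o1) (~~ o2) (~~ o3) Virtual Virtual k3 l1 l2 l3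
    a1 m1 b1 a2 m2 b2 a3 m3 b3.
Proof.
(* The virtual strand keeps [a1]. Each other side takes the colour of the outer half lying beyond
   its virtual crossing after the move. *)
move=> h; exists a1, (if o2 then b2 else a2), (if o3 then a3 else b3).
move: h; rewrite /triangle_law.
case: o1; case: o2; case: o3; case: k3 => /= -[[e1 e2] [e3 e4] [e5 e6]].
all: by split; split; congruence.
Qed.

Lemma triangle_unique o1 o2 o3 k1 k2 k3 l1 l2 l3 a1 n1 b1 a2 n2 b2 a3 n3 b3
    m1 m2 m3 :
  triangle_law o1 o2 o3 k1 k2 k3 l1 l2 l3 a1 n1 b1 a2 n2 b2 a3 n3 b3 ->
  triangle_law o1 o2 o3 k1 k2 k3 l1 l2 l3 a1 m1 b1 a2 m2 b2 a3 m3 b3 ->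
  [/\ n1 = m1, n2 = m2 & n3 = m3].
Proof.
case=> h1 h2 h3 [h1' h2' h3'].
have [-> ->] := corner_unique h1 h1'.
by have [-> _] := corner_unique h2 h2'.
Qed.

End LocalLaws.

Lemma crossing_law_dual (X : mcBiquandle) k l s (p q : X * X) :
  crossing_law k l s p q <->
  @crossing_law (dual X) (opposite_kind k) l s p q.
Proof. by case: k => //=; split=> -[]. Qed.

Definition side_has (h : height) k s k' s' :=
  strand_height k s = h /\ strand_height k' (~~ s') = h.

Definition triangle_side h o1 o2 o3 k1 k2 k3 :=
  [\/ side_has h k1 (o3 (+) o1) k2 (o1 (+) o2),
      side_has h k2 (o1 (+) o2) k3 (o2 (+) o3)
    | side_has h k3 (o2 (+) o3) k1 (o3 (+) o1)].

(** A rotation makes the virtual side the first one, or makes the top and bottom sides the first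
    two. If the bottom side comes before the top one, the dual mc-biquandle reverses their
    heights. *)
Lemma triangle_exists (X : mcBiquandle) o1 o2 o3 k1 k2 k3 l1 l2 l3
    (a1 n1 b1 a2 n2 b2 a3 n3 b3 : X) :
  admissible l1 l2 l3 ->
  (triangle_side Upper o1 o2 o3 k1 k2 k3 /\ triangle_side Lower o1 o2 o3 k1 k2 k3)
    \/ triangle_side Flat o1 o2 o3 k1 k2 k3 ->
  triangle_law o1 o2 o3 k1 k2 k3 l1 l2 l3 a1 n1 b1 a2 n2 b2 a3 n3 b3 ->
  exists m1 m2 m3, triangle_law (~~ o1) (~~ o2) (~~ o3) k1 k2 k3 l1 l2 l3
    a1 m1 b1 a2 m2 b2 a3 m3 b3.
Proof.
move: (o1) (o2) (o3) (k1) (k2) (k3) (l1) (l2) (l3) (a1) (n1) (b1) (a2) (n2) (b2) (a3) (n3) (b3).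
pose Goal o1 o2 o3 k1 k2 k3 := forall l1 l2 l3 (a1 n1 b1 a2 n2 b2 a3 n3 b3 : X),
  admissible l1 l2 l3 ->
  triangle_law o1 o2 o3 k1 k2 k3 l1 l2 l3 a1 n1 b1 a2 n2 b2 a3 n3 b3 ->
  exists m1 m2 m3, triangle_law (~~ o1) (~~ o2) (~~ o3) k1 k2 k3 l1 l2 l3
    a1 m1 b1 a2 m2 b2 a3 m3 b3.
suff G p1 p2 p3 q1 q2 q3 : 
    (triangle_side Upper p1 p2 p3 q1 q2 q3 /\ triangle_side Lower p1 p2 p3 q1 q2 q3)
    \/ triangle_side Flat p1 p2 p3 q1 q2 q3 -> Goal p1 p2 p3 q1 q2 q3.
  by move=> *; apply: G; eassumption.
have rot r1 r2 r3 j1 j2 j3 : Goal r1 r2 r3 j1 j2 j3 -> Goal r3 r1 r2 j3 j1 j2.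
  move=> G ? ? ? ? ? ? ? ? ? ? ? ? adm /triangle_rot h.
  have [m1 [m2 [m3]]] := G _ _ _ _ _ _ _ _ _ _ _ _ (admissible_rot adm) h.
  by move/triangle_rot/triangle_rot => ?; exists m3, m1, m2.
have flat r1 r2 r3 j1 j2 j3 :
    side_has Flat j1 (r3 (+) r1) j2 (r1 (+) r2) -> Goal r1 r2 r3 j1 j2 j3.
  have flatE k s : strand_height k s = Flat -> k = Virtual by case: k; case: s.
  case=> /flatE -> /flatE -> ? ? ? ? ? ? ? ? ? ? ? ? _.
  exact: triangle_flat.
have upper r1 r2 r3 j1 j2 j3 : side_has Upper j1 (r3 (+) r1) j2 (r1 (+) r2) ->
    side_has Lower j2 (r1 (+) r2) j3 (r2 (+) r3) -> Goal r1 r2 r3 j1 j2 j3.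
  by move=> [h1 h2] [_ h3] ? ? ? ? ? ? ? ? ? ? ? ? adm; apply: triangle_upper.
have lower r1 r2 r3 j1 j2 j3 : side_has Lower j1 (r3 (+) r1) j2 (r1 (+) r2) ->
    side_has Upper j2 (r1 (+) r2) j3 (r2 (+) r3) -> Goal r1 r2 r3 j1 j2 j3.
  move=> [h1 h2] [_ h3] ? ? ? ? ? ? ? ? ? ? ? ? adm.
  have flip k s h : strand_height k s = h -> strand_height (opposite_kind k) s =
      match h with Upper => Lower | Lower => Upper | Flat => Flat end.
    by move=> <-; case: k; case: s.
  case=> /crossing_law_dual d1 /crossing_law_dual d2 /crossing_law_dual d3.
  have := @triangle_upper (dual X) _ _ _ _ _ _ _ _ _ _ _ _ _ _ _ _ _ _ adm
   (flip _ _ _ h1) (flip _ _ _ h2) (flip _ _ _ h3) (And3 d1 d2 d3).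
  by case=> m1 [m2 [m3 [e1 e2 e3]]]; exists m1, m2, m3;
    split; apply/crossing_law_dual.
have clash k s k' s' h h' : side_has h k s k' s' -> side_has h' k s k' s' -> h = h'.
  by case=> <- _ [].
case.
  case; case=> hU; case=> hL; try (by have := clash _ _ _ _ _ _ hU hL);
  first [ exact: upper | exact: lower | by apply: rot; first [ exact: upper | exact: lower]
   | by apply/rot/rot; first [ exact: upper | exact: lower]].
case=> h; first [exact: flat | by apply/rot/flat | by apply/rot/rot/flat].
Qed.

(** * Components of the link, as orbits of [next] *)

Definition joined (D : diagram_code) (p q : passage D) : bool :=
  p \in porbit (next D) q.

Lemma joined_const (D : diagram_code) (A : Type) (v : passage D -> A) :
  (forall p, v (next D p) = v p) -> forall p q, joined p q -> v p = v q.
Proof.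
move=> vE p q /porbitP [i ->]; elim: i => [|i IH]; first by rewrite expg0 perm1.
by rewrite expgSr permM vE.
Qed.

Lemma joined_refl (D : diagram_code) (p : passage D) : joined p p.
Proof. exact: porbit_id. Qed.

Lemma joined_sym (D : diagram_code) (p q : passage D) : joined p q = joined q p.
Proof. exact: porbit_sym. Qed.

Lemma joined_next (D : diagram_code) (p : passage D) : joined (next D p) p.
Proof. by rewrite /joined -{1}[next D]expg1 mem_porbit. Qed.

Lemma joinedP (D : diagram_code) (p q : passage D) :
  reflect (porbit (next D) p = porbit (next D) q) (joined p q).
Proof. by rewrite /joined -eq_porbit_mem; apply: eqP. Qed.

Lemma type_ofE (D : diagram_code) (x : crossing D) s :
  type_of x = if joined (x, s) (x, ~~ s) then single else multi.
Proof. by rewrite /type_of -/(joined _ _); case: s => //=; rewrite joined_sym. Qed.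

(** * Removal of crossings *)

Section Embedding.
Variables (D D' : diagram_code) (f : crossing D' -> crossing D) .
Let F (p : passage D') : passage D := (f p.1, p.2).

(** Guarantees that surviving crossings keep their type: fused edges lie on one component, so orbits
    can be followed through the removed crossings in both directions. *)
Lemma removes_joined (K : {set crossing D}) (g : edge D -> edge D') :
  (forall c, c \notin K <-> exists c', f c' = c) ->
  (forall e1 e2, g e1 = g e2 <-> fused K e1 e2) ->
  (forall p : passage D', g (edge_in (F p)) = edge_in p) ->
  (forall p : passage D', g (edge_out (F p)) = edge_out p) ->
  forall p q : passage D', joined (F p) (F q) = joined p q.
Proof.
move=> fK gK gin gout.
have stepF p : joined (F (next D' p)) (F p).
  have : fused K (edge_out (F p)) (edge_in (F (next D' p))).
    by apply/gK; rewrite gin gout.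
  pose v (e : edge D) := if e is inl q then porbit (next D) q else set0.
  move/(@fused_const _ _ _ v) => /= vE.
  rewrite joined_sym; apply/joinedP.
  rewrite -vE; last by move=> q _; apply/esym/joinedP/joined_next.
  by apply/esym/joinedP/joined_next.
move=> p q; apply/idP/idP; last first.
  move/(@joined_const _ _ (fun p => porbit (next D) (F p))) => E.
  by apply/joinedP/E => r; apply/joinedP.
(* The default [set0] is the value on edges that end up on a circle without crossings. *)
pose v (e : edge D) := if g e is inl q then porbit (next D') q else set0.
have vF r : v (edge_in (F r)) = porbit (next D') r by rewrite /v gin.
move/(@joined_const _ _ (v \o @edge_in D)) => /= E.
apply/joinedP; rewrite -!vF; apply: E => r.
have -> : edge_in (next D r) = edge_out r by [].
case: (boolP (r.1 \in K)) => [rK|/fK [x fx]].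
  by rewrite /v; congr (match _ with inl _ => _ | inr _ => _ end); apply/esym/gK/fused_in_out.
have -> : r = F (x, r.2) by case: r fx => x' s /= <-.
by rewrite /v gin gout; apply/joinedP/joined_next.
Qed.

End Embedding.

(** A colouring of [D'] is seen on [D] as a function [v] that does not change across the crossings
    of [K]. The last three hypotheses trade such a [v] for a colouring of [D] with the same outer
    values; the crossings outside [K] only see outer edges, so their laws carry over. *)
Lemma removes_iso (D D' : diagram_code) (K : {set crossing D})
    (inner : pred (edge D)) : removes K D' ->
  (forall p : passage D, p.1 \notin K -> ~~ inner (edge_in p) && ~~ inner (edge_out p)) ->
  (forall e, exists2 e0, ~~ inner e0 & fused K e e0) ->
  (forall (X : mcBiquandle) (c : edge D -> X), coloring c ->
     exists v : edge D -> X, (forall p, p.1 \in K -> v (edge_in p) = v (edge_out p)) /\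
       forall e, ~~ inner e -> c e = v e) ->
  (forall (X : mcBiquandle) (v : edge D -> X),
     (forall p, p.1 \in K -> v (edge_in p) = v (edge_out p)) ->
     exists c : edge D -> X, (forall x, x \in K -> exists s, crossing_law (kind x) (type_of x) s
        (ends c (x, s)) (ends c (x, ~~ s))) /\
       forall e, ~~ inner e -> c e = v e) ->
  (forall (X : mcBiquandle) (c c' : edge D -> X), coloring c -> coloring c' ->
     (forall e, ~~ inner e -> c e = c' e) -> c =1 c') ->
  mcb_isomorphic (MCB D) (MCB D').
Proof.
case=> f [g [[finj fK fkind] [gsurj gK gin gout]]] outer escape straight bend uniq.
have ftype x (s : bool) : type_of (f x) = type_of x.
  rewrite !(type_ofE _ s); congr (if _ then _ else _).
  exact: (removes_joined fK gK gin gout (x, s) (x, ~~ s)).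
have outerE x (s : bool) : ~~ inner (edge_in (f x, s)) && ~~ inner (edge_out (f x, s)).
  by apply/outer/fK; exists x.
have endsE (X : mcBiquandle) (c : edge D -> X) (c' : edge D' -> X) x (s : bool) :
    (forall e, ~~ inner e -> c e = c' (g e)) ->
    ends c (f x, s) = ends c' (x, s).
  move=> E; have /andP[o1 o2] := outerE x s.
  by rewrite /ends !E // (gin (x, s)) (gout (x, s)).
apply: (@mcb_isomorphic_agree _ _ (fun e e' => ~~ inner e /\ e' = g e)).
- move=> X c cc; have [v [vK vc]] := straight X c cc.
  have vg e1 e2 : g e1 = g e2 -> v e1 = v e2 by move/gK; apply: fused_const.
  pose c' e' := v (sval (cid (gsurj e'))).
  have c'E e : v e = c' (g e) by rewrite /c'; case: cid => e1 /= /vg.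
  have cE e : ~~ inner e -> c e = c' (g e) by move=> /vc ->.
  exists c'; split; last by move=> e e' [he ->]; apply: cE.
  by move=> x s; rewrite -!(endsE _ c) // -fkind -(ftype _ s).
- move=> X c' cc'; have [|c [cK cE]] := bend X (c' \o g).
    by move=> p pK /=; congr c'; apply/gK/fused_in_out.
  exists c; split; last by move=> e e' [he ->]; apply: cE.
  move=> x; case: (boolP (x \in K)) => [/cK [s]|/fK [x' <-] s]; first exact: coloringP.
  by rewrite !(endsE _ _ c') // fkind (ftype _ s).
- move=> X c1 c2 c' cc1 cc2 ac1 ac2; apply: uniq => // e he.
  by rewrite (ac1 e (g e)) // (ac2 e (g e)).
- move=> X c1 c2 c cc1 cc2 ac1 ac2 e'.
  have [e <-] := gsurj e'; have [e0 he0 /gK ->] := escape e.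
  by rewrite -(ac1 e0) // -(ac2 e0).
Qed.

(** * Planar isotopy *)

Lemma joined_map (D D' : diagram_code) (F : passage D -> passage D') :
  (forall p, next D' (F p) = F (next D p)) ->
  forall p q, joined p q -> joined (F p) (F q).
Proof.
move=> FE p q /(@joined_const _ _ (fun p => porbit (next D') (F p))) E.
by apply/joinedP/E => r; rewrite -FE; apply/joinedP/joined_next.
Qed.

Lemma isotopic_iso (D D' : diagram_code) :
  planar_isotopic D D' -> mcb_isomorphic (MCB D) (MCB D').
Proof.
case=> circE [f [[f' fK f'K] fk fn]].
pose P (p : passage D) : passage D' := (f p.1, p.2).
pose P' (p : passage D') : passage D := (f' p.1, p.2).
have PK : cancel P P' by case=> x s; rewrite /P' /= fK.
have P'K : cancel P' P by case=> x s; rewrite /P /= f'K.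
have PE p : next D' (P p) = P (next D p) by exact: fn.
have P'E p : next D (P' p) = P' (next D' p) by rewrite -{2}(P'K p) PE PK.
pose F (e : edge D) : edge D' :=
  match e with inl p => inl (P p) | inr i => inr (cast_ord circE i) end.
pose F' (e : edge D') : edge D :=
  match e with inl p => inl (P' p) | inr i => inr (cast_ord (esym circE) i) end.
have FK : cancel F F' by case=> [p|i] /=; rewrite ?PK ?cast_ordK.
have F'K : cancel F' F by case=> [p|i] /=; rewrite ?P'K ?cast_ordKV.
have ftype (x : crossing D) (s : bool) : type_of (f x) = type_of x.
  rewrite !(type_ofE _ s); congr (if _ then _ else _); apply/idP/idP.
    by move=> h; move: (joined_map P'E h); rewrite /P' /= fK.
  by move=> h; have := joined_map PE h.
have endsE (X : mcBiquandle) (c : edge D' -> X) x (s : bool) :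
  ends (c \o F) (x, s) = ends c (f x, s).
  by rewrite /ends /comp /edge_out /= -PE.
apply: (@mcb_isomorphic_agree D D' (fun e e' => e' = F e)).
- move=> X c cc; exists (c \o F'); split; last by move=> e _ -> /=; rewrite FK.
  move=> x s; rewrite -(f'K x) -!endsE (ftype _ s) fk.
  suff -> : (c \o F') \o F = c by apply: cc.
  by apply/funext => e /=; rewrite FK.
- move=> X c cc; exists (c \o F); split; last by move=> e _ ->.
  by move=> x s; rewrite !endsE -(ftype _ s) -fk; apply: cc.
- by move=> X c1 c2 c' _ _ a1 a2 e; rewrite (a1 _ _ erefl) (a2 _ _ erefl).
- by move=> X c1 c2 c _ _ a1 a2 e; rewrite -(F'K e) -(a1 _ _ erefl) -(a2 _ _ erefl).
Qed.

(** Justifies the strand [o' (+) o] in the local laws: it is read off the counterclockwise order of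
    the four half-strands at a crossing. *)
Lemma faceP (D : diagram_code) (d d' : dart D) : face d = d' ->
  [/\ d'.1.2 = d.2 (+) d'.2, (opposite d).1 = (d'.1.1, ~~ d'.1.2) &
      if d.2 then next D d.1 = (d'.1.1, ~~ d'.1.2)
      else next D (d'.1.1, ~~ d'.1.2) = d.1].
Proof.
move=> <-; case: d => p [] /=; rewrite /face /opposite /=.
  by case: (next D p) => x [].
have : next D ((next D)^-1%g p) = p by rewrite permKV.
by case: ((next D)^-1%g p) => x [].
Qed.

Lemma mem_edge_out (D : diagram_code) (P : seq (passage D)) (p : passage D) :
  (edge_out p \in [seq edge_out q | q <- P]) = (p \in P).
Proof. by rewrite mem_map // => q r [] /perm_inj. Qed.

Lemma mem_edge_in (D : diagram_code) (P : seq (passage D)) (p : passage D) :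
  (edge_in p \in [seq edge_out q | q <- P]) = (p \in [seq next D q | q <- P]).
Proof.
by apply/mapP/mapP => -[q qP]; [case=> -> | move=> ->]; exists q.
Qed.

(** * Edges that bound a face *)

Section Sides.
Variables (D : diagram_code) (P : seq (passage D)).
Hypothesis uniqP : uniq (P ++ [seq next D p | p <- P]).

(** The passages at the ends of the sides are pairwise distinct, so no side continues another
    one. *)
Lemma side_in_outer p : p \in P -> edge_in p \notin [seq edge_out q | q <- P].
Proof.
move=> pP; rewrite mem_edge_in; move: uniqP; rewrite cat_uniq => /and3P [_ h _].
by apply: contra h => nP; apply/hasP; exists p.
Qed.

Lemma side_out_outer p :
  p \in P -> edge_out (next D p) \notin [seq edge_out q | q <- P].
Proof.
move=> pP; rewrite mem_edge_out; move: uniqP; rewrite cat_uniq => /and3P [_ h _].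
by apply: contra h => nP; apply/hasP; exists (next D p) => //; apply: map_f.
Qed.

Lemma recolor (A : Type) (v : edge D -> A) (m : passage D -> A) :
  exists w : edge D -> A, (forall p, p \in P -> w (edge_out p) = m p) /\
    (forall e, e \notin [seq edge_out q | q <- P] -> v e = w e).
Proof.
(* An edge is named by the passage into which it leads, so the side leaving [p] is found through the
   inverse of [next]; circles leave no passage. *)
pose prev (e : edge D) := if e is inl q then Some ((next D)^-1%g q) else None.
exists (fun e => if prev e is Some p then if p \in P then m p else v e else v e).
split=> [p pP|[q|i] //=]; first by rewrite /= permK pP.
by rewrite (mem_edge_in P q); case: ifP => // qP /negP []; apply/mapP;
  exists ((next D)^-1%g q); rewrite ?permKV.
Qed.

End Sides.

(* P lists the passages at which the strands enter the sides of the region. *)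
Lemma removes_sides_iso (D D' : diagram_code) (K : {set crossing D})
    (P : seq (passage D)) : removes K D' ->
  (forall p, p \in P -> [/\ p.1 \in K, (next D p).1 \in K & p \notin [seq next D q | q <- P]]) ->
  let inner := [in [seq edge_out q | q <- P]] in
  (forall (X : mcBiquandle) (c : edge D -> X), coloring c ->
     exists v : edge D -> X, (forall p, p.1 \in K -> v (edge_in p) = v (edge_out p)) /\
       forall e, ~~ inner e -> c e = v e) ->
  (forall (X : mcBiquandle) (v : edge D -> X),
     (forall p, p.1 \in K -> v (edge_in p) = v (edge_out p)) ->
     exists c : edge D -> X, (forall x, x \in K -> exists s, crossing_law (kind x) (type_of x) s
        (ends c (x, s)) (ends c (x, ~~ s))) /\
       forall e, ~~ inner e -> c e = v e) ->
  (forall (X : mcBiquandle) (c c' : edge D -> X), coloring c -> coloring c' ->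
     (forall e, ~~ inner e -> c e = c' e) -> c =1 c') ->
  mcb_isomorphic (MCB D) (MCB D').
Proof.
move=> rem PK inner; apply: (removes_iso rem).
  move=> p pK; rewrite /inner /= mem_edge_in mem_edge_out; apply/andP; split.
    by apply: contra pK => /mapP [q /PK [_ qK _] ->].
  by apply: contra pK => /PK [].
move=> e; case: (boolP (inner e)) => [/mapP [p pP ->]|]; last first.
  by exists e => //; rewrite /fused connect0.
have [pK _ pn] := PK p pP; exists (edge_in p); first by rewrite /inner /= mem_edge_in.
by rewrite /fused fused_sym; apply: fused_in_out.
Qed.

(** Names a side by the passage at which its strand enters it, whatever the direction of the walk;
    [side] is applied to the passages themselves. *)
Lemma face_side (D : diagram_code) (d d' : dart D) : face d = d' ->
  exists p : passage D, (d.1, (d'.1.1, ~~ d'.1.2)) = side d.2 p (next D p) p.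
Proof.
case/faceP=> _ _; case: d => p [] /= E; first by exists p; rewrite E.
by exists (d'.1.1, ~~ d'.1.2); rewrite E.
Qed.

Definition side_ends (D : diagram_code) (A : Type) (c : edge D -> A) o p :=
  side o (c (edge_in p)) (c (edge_out p)) (c (edge_out (next D p))).

Lemma ends_side (D : diagram_code) (A : Type) (c : edge D -> A) o (p u u' : passage D) :
  (u, u') = side o p (next D p) p ->
  ends c u = side_ends c o p /\ ends c u' = side_ends c (~~ o) p.
Proof. by case: o => /= -[-> ->]. Qed.

Lemma joined_congr (D : diagram_code) (p p' q q' : passage D) :
  joined p p' -> joined q q' -> joined p q = joined p' q'.
Proof. by rewrite /joined -!eq_porbit_mem => /eqP -> /eqP ->. Qed.

Lemma joined_side (D : diagram_code) o (p u u' : passage D) :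
  (u, u') = side o p (next D p) p -> joined u u'.
Proof.
have pn := joined_next p.
by case: o => /= -[-> ->] //; rewrite joined_sym.
Qed.

(** * The monogon and the bigon moves *)

Lemma move1_iso (D D' : diagram_code) : move1 D D' -> mcb_isomorphic (MCB D) (MCB D').
Proof.
case=> d dd rem; have [sd _ _] := faceP dd; have [p] := face_side dd.
case: d {dd} sd rem => -[x s] o /=; rewrite addbb => -> {s} /= rem pE.
have [pK nK np] : [/\ p.1 = x, (next D p).1 = x & next D p != p].
  by case: o pE => -[<- <-]; rewrite xpair_eqE andbF.
have single_x : type_of x = single.
  by rewrite (type_ofE _ false) (joined_side pE).
have inK y : y \in [set x] -> y = x by move/set1P.
have ppK q : q.1 \in [set x] -> q = p \/ q = next D p.
  case: q => y t /inK /= ->; case: o t pE => -[] [<- <-]; by [left | right].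
have lawE (X : mcBiquandle) (c : edge D -> X) : 
  kink_law (kind x) o (c (edge_in p)) (c (edge_out p)) (c (edge_out (next D p))) =
  crossing_law (kind x) (type_of x) false (ends c (x, false)) (ends c (x, true)).
  by have [-> ->] := ends_side c pE; rewrite single_x.
have outE : (edge_out (next D p) == edge_out p) = false.
  by apply/eqP => -[/perm_inj e]; rewrite e eqxx in np.
have inE' : (edge_in p == edge_out p) = false.
  by apply/eqP => -[e]; rewrite -e eqxx in np.
apply: (removes_sides_iso (P := [:: p]) rem) => /=.
- by move=> q; rewrite mem_seq1 => /eqP ->; rewrite !inE pK nK eqxx eq_sym.
- move=> X c cc; have := cc x false; rewrite -lawE => /kink_closed ab.
  (* Straightened, the loop takes the common colour of the two outer ends. *)
  exists (fun e => if e == edge_out p then c (edge_in p) else c e); split.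
    move=> q /ppK [] ->; first by rewrite eqxx inE'.
    by rewrite eqxx outE.
  by move=> e; rewrite inE => /negPf ->.
- move=> X v vK; have [n kn] := kink_exists (kind x) o (v (edge_in p)).
  exists (fun e => if e == edge_out p then n else v e); split.
    move=> y /inK ->; exists false; rewrite -lawE inE' outE eqxx -[v (edge_out _)]vK ?nK ?inE //.
    by rewrite -[edge_in (next D p)]/(edge_out p) -vK ?pK ?inE.
  by move=> e; rewrite inE => /negPf ->.
- move=> X c c' cc cc' E e; case: (e =P edge_out p) => [->|/eqP ne]; last first.
    by apply: E; rewrite inE.
  have := cc x false; have := cc' x false; rewrite -!lawE.
  rewrite (E (edge_in p)) ?(E (edge_out (next D p))) ?mem_seq1 ?outE ?inE' //.
  by move=> h' h; apply: kink_unique h h'.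
Qed.

Lemma strand_heightE (D : diagram_code) (p : passage D) :
  height_of p = strand_height (kind p.1) p.2.
Proof. by []. Qed.

Lemma move2_iso (D D' : diagram_code) : move2 D D' -> mcb_isomorphic (MCB D) (MCB D').
Proof.
case=> d1 [d2 [f1 f2 nx hh rem]].
have [s2 o1 _] := faceP f1; have [s1 _ _] := faceP f2.
have [p1 p1E] := face_side f1; have [p2 p2E] := face_side f2.
move: hh; rewrite o1 !strand_heightE /= => hh.
case: d1 d2 {f1 f2 o1} nx rem s1 s2 hh p1E p2E => -[x1 s1] o1 [[x2 s2] o2] /=.
move=> nx rem s1E s2E hh p1E p2E.
(* Side 1 is on strand [s1] at [x1] and on strand [~~ s2] at [x2], while [s1 = s2]; equal heights
   therefore mean opposite kinds. *)
have kE : kind x2 = opposite_kind (kind x1).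
  move: hh; rewrite s1E s2E addbC.
  by case: (kind x1); case: (kind x2); case: (_ (+) _).
have tE : type_of x2 = type_of x1.
  rewrite (type_ofE x1 s1) (type_ofE x2 s2).
  rewrite (joined_congr (joined_side p1E) (etrans (joined_sym _ _) (joined_side p2E))).
  by rewrite joined_sym.
set P := [:: p1; p2].
(* Four distinct passages occur in a list of length four, so that list has no repetition and nothing
   else in it. *)
have subU : {subset [:: (x1, s1); (x1, ~~ s1); (x2, s2); (x2, ~~ s2)]
     <= P ++ [seq next D q | q <- P]}.
  move=> q; rewrite !inE.
  by case: o1 p1E {s1E s2E} => -[-> ->]; case: o2 p2E => -[-> ->];
    case/or4P=> ->; rewrite ?orbT.
have uniqU : uniq [:: (x1, s1); (x1, ~~ s1); (x2, s2); (x2, ~~ s2)].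
  rewrite /= !inE !xpair_eqE (negPf nx) !eqxx /= !andbT.
  by case: s1 {s1E s2E p1E p2E subU hh}; case: s2.
have uniqP : uniq (P ++ [seq next D q | q <- P]) by apply: leq_size_uniq uniqU subU _.
have PE : [:: (x1, s1); (x1, ~~ s1); (x2, s2); (x2, ~~ s2)]
    =i P ++ [seq next D q | q <- P].
  by have [] := uniq_min_size uniqU subU.
have KP q : (q.1 \in [set x1; x2]) = (q \in P ++ [seq next D r | r <- P]).
  rewrite -PE !inE; case: q => y t; rewrite !xpair_eqE /=.
  by case: (y == x1); case: (y == x2); case: t; case: s1 {s1E s2E p1E p2E subU uniqU hh PE};
   case: s2.
have p1P : p1 \in P by rewrite inE eqxx.
have p2P : p2 \in P by rewrite !inE eqxx orbT.
have np12 : (p2 == p1) = false.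
  by apply/negbTE; move: uniqP; rewrite /= !inE eq_sym => /and4P [/norP []].
have in1 := side_in_outer uniqP p1P; have in2 := side_in_outer uniqP p2P.
have out1 := side_out_outer uniqP p1P; have out2 := side_out_outer uniqP p2P.
pose law (X : mcBiquandle) (c : edge D -> X) :=
  bigon_law (kind x1) (opposite_kind (kind x1)) (type_of x1) o1 o2
    (c (edge_in p1)) (c (edge_out p1)) (c (edge_out (next D p1)))
    (c (edge_in p2)) (c (edge_out p2)) (c (edge_out (next D p2))).
have lawE (X : mcBiquandle) (c : edge D -> X) : law X c <->
    crossing_law (kind x1) (type_of x1) s1 (ends c (x1, s1)) (ends c (x1, ~~ s1)) /\
    crossing_law (kind x2) (type_of x2) s2 (ends c (x2, s2)) (ends c (x2, ~~ s2)).
  have [-> ->] := ends_side c p1E; have [-> ->] := ends_side c p2E.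
  by rewrite kE tE s1E s2E.
apply: (removes_sides_iso (P := P) rem) => /=.
- move=> q qP; rewrite !KP !mem_cat qP map_f ?orbT //; split=> //.
  by have := side_in_outer uniqP qP; rewrite mem_edge_in.
- move=> X c cc; have /lawE /bigon_closed [e1 e2] := conj (cc x1 s1) (cc x2 s2).
  have [v [vP vE]] := recolor P c (fun p => c (edge_in p)).
  exists v; split=> // q; rewrite KP mem_cat => /orP [qP|/mapP [p pP ->]].
    by rewrite vP // -vE // side_in_outer.
  rewrite -[edge_in (next D p)]/(edge_out p) vP // -vE ?side_out_outer //.
  by move: pP; rewrite !inE => /orP [] /eqP ->.
- move=> X v vK.
  have vE p : p \in P -> v (edge_out (next D p)) = v (edge_in p).
    move=> pP; rewrite [RHS]vK ?KP ?mem_cat ?pP // -[edge_out p]/(edge_in (next D p)).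
    by rewrite [RHS]vK // KP mem_cat map_f ?orbT.
  have [n1 [n2 h]] := bigon_exists (kind x1) (type_of x1) o1 o2
    (v (edge_in p1)) (v (edge_in p2)).
  have [c [cP cE]] := recolor P v (fun p => if p == p1 then n1 else n2).
  exists c; split; last by move=> e /cE.
  have /lawE [h1 h2] : law X c.
    by rewrite /law (cP p1) // (cP p2) // -!cE // eqxx np12 !vE.
  by move=> y /set2P [] ->; [exists s1 | exists s2].
- move=> X c c' cc cc' E.
  have /lawE h := conj (cc x1 s1) (cc x2 s2).
  have /lawE h' := conj (cc' x1 s1) (cc' x2 s2).
  have [e1 e2] : c (edge_out p1) = c' (edge_out p1) /\ c (edge_out p2) = c' (edge_out p2).
    by apply: bigon_unique h _; rewrite !E.
  move=> e; case: (boolP (e \in [seq edge_out q | q <- P])) => [|/E //].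
  by rewrite /= !inE => /orP [] /eqP ->.
Qed.

(** * The triangle move, as a conjugation of [next] *)

Definition conj_code (D : diagram_code) (s : {perm passage D}) : diagram_code :=
  DiagramCode (@kind D) (next D ^ s)%g (circles D).

Section Conjugate.
Variables (D : diagram_code) (s : {perm passage D}).
Hypothesis s_joined : forall p, joined (s p) p.

(** After conjugation the link runs through [s p] where it ran through [p]; an edge follows the
    passage into which it leads. *)
Definition conj_edge (e : edge D) : edge (conj_code s) :=
  match e with inl p => inl (s p) | inr i => inr i end.

Definition unconj_edge (e : edge (conj_code s)) : edge D :=
  match e with inl p => inl (s^-1%g p) | inr i => inr i end.

Lemma conj_edgeK : cancel conj_edge unconj_edge.
Proof. by case=> //= p; rewrite permK. Qed.

Lemma unconj_edgeK : cancel unconj_edge conj_edge.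
Proof. by case=> //= p; rewrite permKV. Qed.

Lemma ends_conj (A : Type) (c : edge (conj_code s) -> A) (p : passage D) :
  ends c (s p : passage (conj_code s)) = ends (c \o conj_edge) p.
Proof. by rewrite /ends /= /edge_out /= permJ. Qed.

(** Conjugation transports components by [s], and [s] moves each passage within its own
    component. *)
Lemma type_of_conj (x : crossing D) :
  type_of (x : crossing (conj_code s)) = type_of x.
Proof.
have pull p q : @joined (conj_code s) (s p) (s q) = joined p q.
  apply/idP/idP.
    move=> h; rewrite -(permK s p) -(permK s q).
    apply: (@joined_map (conj_code s) D (s^-1)%g) h => r.
    by rewrite /= -{2}(permKV s r) permJ permK.
  by apply: (@joined_map D (conj_code s) s) => r /=; rewrite permJ.
have sV p : joined (s^-1%g p) p.
  by rewrite joined_sym -{1}(permKV s p).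
rewrite (type_ofE (D := conj_code s) _ true) (type_ofE _ true); congr (if _ then _ else _).
have := pull (s^-1%g (x, true)) (s^-1%g (x, ~~ true)); rewrite !permKV => ->.
by rewrite (joined_congr (sV _) (sV _)).
Qed.

End Conjugate.

(** With [a], [b], [c] the components of three strands, transitivity of equality excludes exactly
    one unequal pair. *)
Lemma admissible_eq (T : eqType) (a b c : T) :
  admissible (if a == c then single else multi) (if b == a then single else multi)
    (if c == b then single else multi).
Proof.
have [<-|nac] := eqVneq a c; first by rewrite (eq_sym a); case: (b == a).
have [->|_] := eqVneq b a; last by case: (c == b).
by rewrite eq_sym (negPf nac).
Qed.

Lemma move3_iso (D D' : diagram_code) : move3 D D' -> mcb_isomorphic (MCB D) (MCB D').
Proof.
case=> d1 [d2 [d3 [[f1 f2 f3 ux hh] iso]]].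
apply: mcb_isomorphic_trans (isotopic_iso iso) => {iso}.
have [s2 o1 _] := faceP f1; have [s3 o2 _] := faceP f2; have [s1 o3 _] := faceP f3.
have [p1 p1E] := face_side f1; have [p2 p2E] := face_side f2.
have [p3 p3E] := face_side f3.
move: hh; rewrite /side_height o1 o2 o3 !strand_heightE /=.
case: d1 d2 d3 {f1 f2 f3 o1 o2 o3} ux s1 s2 s3 p1E p2E p3E
  => -[x1 s1] o1 [[x2 s2] o2] [[x3 s3] o3] /=.
rewrite !inE andbT negb_or => ux s1E s2E s3E p1E p2E p3E hh.
set s := (_ * _ * _)%g; rewrite -/(conj_code s).
have {hh} hh : (triangle_side Upper o1 o2 o3 (kind x1) (kind x2) (kind x3) /\
    triangle_side Lower o1 o2 o3 (kind x1) (kind x2) (kind x3)) \/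
    triangle_side Flat o1 o2 o3 (kind x1) (kind x2) (kind x3).
  by move: hh; rewrite s1E s2E s3E.
have {ux} [n12 n13 n23] : [/\ x1 != x2, x1 != x3 & x2 != x3].
  by case/andP: ux => /andP [].
set P := [:: p1; p2; p3].
set U := [:: (x1, s1); (x1, ~~ s1); (x2, s2); (x2, ~~ s2); (x3, s3); (x3, ~~ s3)].
have subU : {subset U <= P ++ [seq next D q | q <- P]}.
  move=> q; rewrite !inE.
  case: o1 p1E {s1E s2E s3E hh} => -[-> ->]; case: o2 p2E => -[-> ->];
    case: o3 p3E => -[-> ->]; 
    do 5! (case/orP => [->|]; first by rewrite ?orbT); by move=> ->; rewrite ?orbT.
have uniqU : uniq U.
  rewrite /= !inE !xpair_eqE (negPf n12) (negPf n13) (negPf n23) !eqxx /= !andbT.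
  by case: s1 {s1E s2E s3E p1E p2E p3E subU s U}; case: s2; case: s3.
have uniqP : uniq (P ++ [seq next D q | q <- P]) by apply: leq_size_uniq uniqU subU _.
have PE : U =i P ++ [seq next D q | q <- P] by have [] := uniq_min_size uniqU subU.
have UP q : (q.1 \in [:: x1; x2; x3]) = (q \in P ++ [seq next D r | r <- P]).
  rewrite -PE !inE; case: q => y t; rewrite !xpair_eqE /=.
  by case: (y == x1); case: (y == x2); case: (y == x3); case: t;
    case: s1 {s1E s2E s3E p1E p2E p3E subU uniqU PE s U}; case: s2; case: s3.
have neq y t y' t' : y != y' -> (y, t) != (y', t') :> passage D.
  by move=> h; rewrite xpair_eqE negb_and h.
have nn y t : (y, ~~ t) != (y, t) :> passage D by rewrite xpair_eqE eqxx; case: t.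
have nn' y t : (y, t) != (y, ~~ t) :> passage D by rewrite eq_sym.
have [n21 n31 n32] : [/\ x2 != x1, x3 != x1 & x3 != x2] by split; rewrite eq_sym.
(* The three transpositions have disjoint supports, so [s] sends each end of a side to its other
   end. *)
have st1 : s (x1, s1) = (x2, ~~ s2) by rewrite !permM tpermL !tpermD ?nn ?nn' ?neq //.
have en1 : s (x2, ~~ s2) = (x1, s1) by rewrite !permM tpermR !tpermD ?nn ?nn' ?neq //.
have st2 : s (x2, s2) = (x3, ~~ s3).
  by rewrite !permM (tpermD (z := (x2, s2))) ?tpermL ?tpermD ?nn ?nn' ?neq //.
have en2 : s (x3, ~~ s3) = (x2, s2).
  by rewrite !permM (tpermD (z := (x3, ~~ s3))) ?tpermR ?tpermD ?nn ?nn' ?neq //.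
have st3 : s (x3, s3) = (x1, ~~ s1).
  by rewrite !permM (@tpermD _ (x1, s1)) 1?(@tpermD _ (x2, s2)) ?tpermL ?nn ?nn' ?neq.
have en3 : s (x1, ~~ s1) = (x3, s3).
  by rewrite !permM (@tpermD _ (x1, s1)) 1?(@tpermD _ (x2, s2)) ?tpermR ?nn ?nn' ?neq.
have fix_s y t : y \notin [:: x1; x2; x3] -> s (y, t) = (y, t).
  rewrite !inE !negb_or ![y == _]eq_sym => /and3P [? ? ?].
  by rewrite !permM !tpermD ?nn ?nn' ?neq //.
have s_joined p : joined (s p) p.
  case: (boolP (p.1 \in [:: x1; x2; x3])) => [|h]; last first.
    by case: p h => y t h; rewrite fix_s // joined_refl.
  have j1 := joined_side p1E; have j2 := joined_side p2E; have j3 := joined_side p3E.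
  rewrite UP -PE; do 5! (rewrite in_cons => /orP [/eqP ->|]; first by
    rewrite ?st1 ?st2 ?st3 ?en1 ?en2 ?en3 // joined_sym).
  by rewrite mem_seq1 => /eqP ->; rewrite en2 // joined_sym.
have adm : admissible (type_of x1) (type_of x2) (type_of x3).
  rewrite (type_ofE x1 s1) (type_ofE x2 s2) (type_ofE x3 s3).
  rewrite -(joined_congr (joined_refl (x1, s1)) (joined_side p3E)).
  rewrite -(joined_congr (joined_refl (x2, s2)) (joined_side p1E)).
  rewrite -(joined_congr (joined_refl (x3, s3)) (joined_side p2E)).
  by rewrite /joined -!eq_porbit_mem; apply: admissible_eq.
pose law r1 r2 r3 (X : mcBiquandle) (c : edge D -> X) :=
  triangle_law r1 r2 r3 (kind x1) (kind x2) (kind x3)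
    (type_of x1) (type_of x2) (type_of x3)
    (c (edge_in p1)) (c (edge_out p1)) (c (edge_out (next D p1)))
    (c (edge_in p2)) (c (edge_out p2)) (c (edge_out (next D p2)))
    (c (edge_in p3)) (c (edge_out p3)) (c (edge_out (next D p3))).
pose far (X : mcBiquandle) (c : edge D -> X) :=
  forall x t, x \notin [:: x1; x2; x3] ->
    crossing_law (kind x) (type_of x) t (ends c (x, t)) (ends c (x, ~~ t)).
have near x : x \in [:: x1; x2; x3] -> [\/ x = x1, x = x2 | x = x3].
  by rewrite !inE => /or3P [] /eqP ->; [constructor 1 | constructor 2 | constructor 3].
have coloringE (X : mcBiquandle) (c : edge D -> X) :
    coloring c <-> law o1 o2 o3 X c /\ far X c.
  have [e1 e1'] := ends_side c p1E; have [e2 e2'] := ends_side c p2E.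
  have [e3 e3'] := ends_side c p3E.
  split=> [cc|[[l1 l2 l3] fc] x].
    split; last by move=> x t _.
    by have := (cc x1 s1, cc x2 s2, cc x3 s3);
      rewrite e1 e1' e2 e2' e3 e3' s1E s2E s3E => -[[]].
  case: (boolP (x \in [:: x1; x2; x3])) => [/near [] ->|/fc h]; last exact: h.
  - by apply: (@coloringP _ _ _ _ s1); rewrite e1 e3' s1E.
  - by apply: (@coloringP _ _ _ _ s2); rewrite e2 e1' s2E.
  - by apply: (@coloringP _ _ _ _ s3); rewrite e3 e2' s3E.
pose up (X : mcBiquandle) (c : edge (conj_code s) -> X) := c \o (@conj_edge D s).
(* Carried back to the edges of [D], the law of the turned triangle is the old one with every [o]
   negated, since each strand meets its two crossings in the reverse order. *)
have coloring'E (X : mcBiquandle) (c : edge (conj_code s) -> X) :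
    coloring c <-> law (~~ o1) (~~ o2) (~~ o3) X (up X c) /\ far X (up X c).
  have upE p : ends c (s p : passage (conj_code s)) = ends (up X c) p.
    exact: ends_conj.
  have [e1 e1'] := ends_side (up X c) p1E; have [e2 e2'] := ends_side (up X c) p2E.
  have [e3 e3'] := ends_side (up X c) p3E.
  have law1 : crossing_law (kind x1) (type_of x1) s1
      (ends c ((x1, s1) : passage (conj_code s))) (ends c ((x1, ~~ s1) : passage (conj_code s)))
      = crossing_law (kind x1) (type_of x1) (~~ o3 (+) ~~ o1)
        (side_ends (up X c) (~~ o1) p1) (side_ends (up X c) (~~ ~~ o3) p3).
    by rewrite -en1 -st3 !upE e1' e3 negbK addbN addNb negbK s1E.
  have law2 : crossing_law (kind x2) (type_of x2) s2
      (ends c ((x2, s2) : passage (conj_code s))) (ends c ((x2, ~~ s2) : passage (conj_code s)))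
      = crossing_law (kind x2) (type_of x2) (~~ o1 (+) ~~ o2)
        (side_ends (up X c) (~~ o2) p2) (side_ends (up X c) (~~ ~~ o1) p1).
    by rewrite -en2 -st1 !upE e2' e1 negbK addbN addNb negbK s2E.
  have law3 : crossing_law (kind x3) (type_of x3) s3
      (ends c ((x3, s3) : passage (conj_code s))) (ends c ((x3, ~~ s3) : passage (conj_code s)))
      = crossing_law (kind x3) (type_of x3) (~~ o2 (+) ~~ o3)
        (side_ends (up X c) (~~ o3) p3) (side_ends (up X c) (~~ ~~ o2) p2).
    by rewrite -en3 -st2 !upE e3' e2 negbK addbN addNb negbK s3E.
  have ccE : coloring c <-> forall (x : crossing D) t, crossing_law (kind x) (type_of x) t
      (ends c ((x, t) : passage (conj_code s))) (ends c ((x, ~~ t) : passage (conj_code s))).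
    by split=> h x t; have := h x t; rewrite type_of_conj.
  have endsE y t : y \notin [:: x1; x2; x3] ->
      ends c ((y, t) : passage (conj_code s)) = ends (up X c) (y, t).
    by move=> hy; rewrite -{1}(fix_s y t) // upE.
  split=> [/ccE cc|[[l1 l2 l3] fc]].
    split; last by move=> x t hx; rewrite -!endsE.
    by have := (cc x1 s1, cc x2 s2, cc x3 s3); rewrite law1 law2 law3 => -[[]].
  move=> x; case: (boolP (x \in [:: x1; x2; x3])) => [/near [] ->|h].
  - by apply: (@coloringP (conj_code s) _ _ x1 s1); rewrite type_of_conj ?law1.
  - by apply: (@coloringP (conj_code s) _ _ x2 s2); rewrite type_of_conj ?law2.
  - by apply: (@coloringP (conj_code s) _ _ x3 s3); rewrite type_of_conj ?law3.
  - by move=> t; rewrite type_of_conj // !endsE //; apply: fc.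
have farE (X : mcBiquandle) (c w : edge D -> X) :
    (forall e, e \notin [seq edge_out q | q <- P] -> c e = w e) -> far X c -> far X w.
  move=> E fc x t hx; have := fc x t hx.
  suff endsE r : ends c (x, r) = ends w (x, r) by rewrite !endsE.
  have := UP (x, r); rewrite (negPf hx) mem_cat => /esym /norP [nP nN].
  rewrite /ends; congr (_, _); apply: E; first by rewrite mem_edge_in.
  by rewrite mem_edge_out.
have p1P : p1 \in P by rewrite inE eqxx.
have p2P : p2 \in P by rewrite !inE eqxx orbT.
have p3P : p3 \in P by rewrite !inE eqxx !orbT.
have [np12 np13 np23] : [/\ (p2 == p1) = false, (p3 == p1) = false & (p3 == p2) = false].
  move: uniqP; rewrite cat_uniq /= !inE negb_or andbT => /andP [/andP [/andP [? ?] ?] _].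
  by split; apply/negbTE; rewrite eq_sym.
have in1 := side_in_outer uniqP p1P; have out1 := side_out_outer uniqP p1P.
have in2 := side_in_outer uniqP p2P; have out2 := side_out_outer uniqP p2P.
have in3 := side_in_outer uniqP p3P; have out3 := side_out_outer uniqP p3P.
have slide r1 r2 r3 (X : mcBiquandle) (c : edge D -> X) :
    (triangle_side Upper r1 r2 r3 (kind x1) (kind x2) (kind x3) /\
     triangle_side Lower r1 r2 r3 (kind x1) (kind x2) (kind x3)) \/
     triangle_side Flat r1 r2 r3 (kind x1) (kind x2) (kind x3) ->
    law r1 r2 r3 X c -> far X c -> exists w : edge D -> X,
      [/\ law (~~ r1) (~~ r2) (~~ r3) X w, far X w &
       forall e, e \notin [seq edge_out q | q <- P] -> c e = w e].
  move=> hr hl hf; have [m1 [m2 [m3 h]]] := triangle_exists adm hr hl.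
  have [w [wP wE]] := recolor P c (fun p => if p == p1 then m1 else if p == p2 then m2 else m3).
  exists w; split=> //; last exact: farE wE hf.
  rewrite /law (wP p1) // (wP p2) // (wP p3) // -!wE //.
  by rewrite !eqxx np12 np13 np23.
have same r1 r2 r3 (X : mcBiquandle) (c c' : edge D -> X) :
    law r1 r2 r3 X c -> law r1 r2 r3 X c' ->
    (forall e, e \notin [seq edge_out q | q <- P] -> c e = c' e) -> c =1 c'.
  move=> h h' E.
  have [e1 e2 e3] : [/\ c (edge_out p1) = c' (edge_out p1),
     c (edge_out p2) = c' (edge_out p2) & c (edge_out p3) = c' (edge_out p3)].
    apply: triangle_unique h _.
    by rewrite (E (edge_in p1)) // (E (edge_in p2)) // (E (edge_in p3)) // !(E (edge_out (next D _))).
  move=> e; case: (boolP (e \in [seq edge_out q | q <- P])) => [|/E //].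
  by rewrite /= !inE => /or3P [] /eqP ->.
(* The heights depend only on the sums [o (+) o'], which survive negating all three, so [slide] also
   applies backwards. *)
have hh' : (triangle_side Upper (~~ o1) (~~ o2) (~~ o3) (kind x1) (kind x2) (kind x3) /\
    triangle_side Lower (~~ o1) (~~ o2) (~~ o3) (kind x1) (kind x2) (kind x3)) \/
    triangle_side Flat (~~ o1) (~~ o2) (~~ o3) (kind x1) (kind x2) (kind x3).
  by rewrite /triangle_side !addbN !addNb !negbK.
apply: (@mcb_isomorphic_agree D (conj_code s)
  (fun e e' => e \notin [seq edge_out q | q <- P] /\ e' = conj_edge s e)).
- move=> X c /coloringE [hl hf]; have [w [wl wf wE]] := slide _ _ _ _ _ hh hl hf.
  have upw : up X (w \o @unconj_edge D s) = w.
    by apply/funext => e; rewrite /up /= conj_edgeK.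
  exists (w \o @unconj_edge D s); split; first by apply/coloring'E; rewrite upw.
  by move=> e e' [he ->] /=; rewrite conj_edgeK wE.
- move=> X c /coloring'E [hl hf]; have [w [wl wf wE]] := slide _ _ _ _ _ hh' hl hf.
  exists w; split; last by move=> e e' [he ->]; rewrite -wE.
  by apply/coloringE; move: wl; rewrite !negbK.
- move=> X c1 c2 c' /coloringE [l1 _] /coloringE [l2 _] a1 a2.
  by apply: same l1 l2 _ => e he; rewrite (a1 e _ (conj he erefl)) (a2 e _ (conj he erefl)).
- move=> X c1 c2 c /coloring'E [l1 _] /coloring'E [l2 _] a1 a2 e'.
  rewrite -(unconj_edgeK e').
  have /(_ (unconj_edge e')) : up X c1 =1 up X c2 by
    apply: same l1 l2 _ => e he; exact: etrans (esym (a1 e _ (conj he erefl))) (a2 e _ (conj he erefl)).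
  by [].
Qed.

Theorem theorem1 (t : link_theory) (D D' : diagram)
  (hD : allowed t D) (hD' : allowed t D') (hL : same_link t D D') :
  mcb_isomorphic (MCB D) (MCB D').
Proof.
elim: hL {hD hD'} => {D D'} [D D' [_ _]|D|D D' _|D D1 D' _ h _ h'].
- by case; [exact: isotopic_iso | exact: move1_iso | exact: move2_iso | exact: move3_iso].
- exact: mcb_isomorphic_refl.
- exact: mcb_isomorphic_sym.
- exact: mcb_isomorphic_trans h h'.
Qed.
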